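(* For all $u_h\in V_h$, $$\|\varepsilon(u_h)\|_{\mathcal T}^2+h^{-1}\big\|\Pi^R[\![u_h]\!]_t\big\|_{\mathcal F_{0,D}}^2\;\sim\;\|\varepsilon(u_h)\|_{\mathcal T}^2+h^{-1}\big\|\Pi^0[\![u_h]\!]_t\big\|_{\mathcal F_{0,D}}^2+h\big\|[\![\operatorname{curl}u_h]\!]_n\big\|_{\mathcal F_{0,D}}^2 .$$
   Context: Setting: $\Omega\subset\mathbb R^3$ is a bounded open domain with Lipschitz boundary split into $\Gamma_D$ and $\Gamma_N$, both of positive surface measure, such that any rigid displacement $x\mapsto a+b\times x$ ($a,b\in\mathbb R^3$) vanishing on $\Gamma_D$ vanishes everywhere in $\Omega$. $\mathcal T$ is a quasiuniform and shape regular triangulation of $\Omega$ into tetrahedra and $h$ is the maximal element diameter. $\mathcal F$ is the set of its facets, split into $\mathcal F_D=\{F\in\mathcal F:F\subset\Gamma_D\}$, $\mathcal F_N=\{F\in\mathcal F:F\subset\Gamma_N\}$ and the interior facets $\mathcal F_0=\mathcal F\setminus(\mathcal F_D\cup\mathcal F_N)$; $\mathcal F_{0,D}=\mathcal F_0\cup\mathcal F_D$. $A\sim B$ means $cA\le B\le CA$ with constants $c,C>0$ independent of $h$ (they may depend on the domain data and the shape-regularity and quasiuniformity constants). Notation: $\varepsilon(u)=\frac12(\nabla u+\nabla u^T)$. $n$ is a unit normal of a facet; $v_n=v\cdot n$, $v_t=v-v_nn$. $[\![v]\!]$ is the jump of $v$ on interior facets (up to sign) and the trace of $v$ on boundary facets.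 $\|\cdot\|_{\mathcal T}^2=\sum_{T\in\mathcal T}\|\cdot\|_{L^2(T)}^2$ and $\|\cdot\|_{\mathcal F_{0,D}}^2=\sum_{F\in\mathcal F_{0,D}}\|\cdot\|_{L^2(F)}^2$, derivatives being taken elementwise. $\Pi^0$ is the facetwise $L^2$ projection onto constants, and $\Pi^R$ is the facetwise $L^2$ projection onto $R_F=\{t+\alpha\,n\times x:t\in n^\perp,\ \alpha\in\mathbb R\}$ (functions of $x\in F$, $n$ a unit normal of $F$). $V_h=\{v_h\in H_{0,D}(\operatorname{div},\Omega):v_h|_T\in P^1(T,\mathbb R^3)\ \forall T\in\mathcal T\}$, where $H_{0,D}(\operatorname{div},\Omega)$ consists of $H(\operatorname{div},\Omega)$ fields with zero normal trace on $\Gamma_D$ and $P^1$ denotes polynomials of degree at most 1. *)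

(* Defs.v *)
From HB Require Import structures.
From mathcomp Require Import all_boot all_order all_algebra.
From mathcomp Require Import all_classical all_reals all_analysis.
Set Implicit Arguments.
Unset Strict Implicit.
Unset Printing Implicit Defensive.
Import Order.TTheory GRing.Theory Num.Theory.
Import numFieldNormedType.Exports.
Local Open Scope classical_set_scope.
Local Open Scope ring_scope.

Section Euclidean.
Context {R : realType}.

Definition dot n (u v : 'rV[R]_n) : R := \sum_(i < n) u 0 i * v 0 i.

(* The library norm of 'rV[R]_n is the maximum norm. *)
Definition enorm n (u : 'rV[R]_n) : R := Num.sqrt (dot u u).

Definition diam n (A : set 'rV[R]_n) : R :=
  sup [set enorm (x - y) | x in A & y in A].

Definition inradius n (A : set 'rV[R]_n) : R :=
  sup [set r | 0 < r /\ exists c, [set x | enorm (x - c) <= r] `<=` A].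

Definition row3 (a b c : R) : 'rV[R]_3 := \row_(i < 3) [:: a; b; c]`_i.

Definition cross (u v : 'rV[R]_3) : 'rV[R]_3 :=
  let u_ k := u 0 (inord k) in let v_ k := v 0 (inord k) in
  row3 (u_ 1%N * v_ 2%N - u_ 2%N * v_ 1%N)
       (u_ 2%N * v_ 0%N - u_ 0%N * v_ 2%N)
       (u_ 0%N * v_ 1%N - u_ 1%N * v_ 0%N).

Definition boundary n (A : set 'rV[R]_n) : set 'rV[R]_n :=
  closure A `\` interior A.

(* The factor pi / 4 is the area of a disc of diameter 1. Since [sup] is 0 on
   unbounded sets, the covering sets have to be required to be bounded. *)
Definition hausdorff2 n (A : set 'rV[R]_n) : \bar R :=
  ereal_sup [set
    ereal_inf [set ((pi / 4)%:E * \sum_(0 <= i <oo) (diam (U i) ^+ 2)%:E)%E | U in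
      [set U : nat -> set 'rV[R]_n | A `<=` \bigcup_i U i /\
        forall i, bounded_set (U i) /\ diam (U i) <= delta]]
    | delta in [set delta : R | 0 < delta]].

End Euclidean.

Section Domain.
Context {R : realType}.
Implicit Types Om GD GN : set 'rV[R]_3.

(* Near each boundary point, after an orthogonal change of coordinates, Om is
   the set below the graph of a Lipschitz function. *)
Definition lipschitz_boundary Om : Prop :=
  forall x0, boundary Om x0 ->
  exists (Q : 'M[R]_3) (g : 'rV[R]_2 -> R^o) (k : R),
    [/\ Q *m Q^T = 1%:M, k.-lipschitz g &
        \forall x \near x0, let y : 'rV[R]_(2 + 1) := x *m Q in
          Om x <-> rsubmx y 0 0 < g (lsubmx y)].

Definition lipschitz_domain Om : Prop :=
  [/\ open Om, connected Om, Om !=set0, bounded_set Om & lipschitz_boundary Om].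

Definition boundary_split Om GD GN : Prop :=
  [/\ boundary Om = GD `|` GN, hausdorff2 (GD `&` GN) = 0%E,
      (0 < hausdorff2 GD)%E & (0 < hausdorff2 GN)%E].

Definition no_rigid_displacement Om GD : Prop :=
  forall a b : 'rV[R]_3, (forall x, GD x -> a + cross b x = 0) ->
  forall x, Om x -> a + cross b x = 0.

End Domain.

Section Analysis.
Context {R : realType}.
Notation pt := 'rV[R]_3.
Implicit Types (Om GD : set pt) (u v : pt -> pt) (phi : pt -> R).

Local Notation lebesgue2 := (@lebesgue_measure R \x @lebesgue_measure R)%E.
Local Notation lebesgue3 := (lebesgue2 \x @lebesgue_measure R)%E.

Definition ref_triangle : set (R * R) :=
  [set p | [/\ 0 <= p.1, 0 <= p.2 & p.1 + p.2 <= 1]].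

Definition of_prod (p : R * R * R) : pt := row3 p.1.1 p.1.2 p.2.

Definition integral3 (A : set pt) (f : pt -> R) : \bar R :=
  \int[lebesgue3]_(p in of_prod @^-1` A) (f (of_prod p))%:E.

(* Surface integral over the triangle with vertices a, b, c. *)
Definition surface_integral (a b c : pt) (f : pt -> R) : \bar R :=
  ((enorm (cross (b - a) (c - a)))%:E *
  \int[lebesgue2]_(p in ref_triangle)
     (f (a + p.1 *: (b - a) + p.2 *: (c - a)))%:E)%E.

Definition L2 (A : set pt) (f : pt -> R) : Prop :=
  measurable_fun (of_prod @^-1` A) (f \o of_prod) /\
  (integral3 A (fun x => f x ^+ 2)%R < +oo)%E.

Definition partial (i : 'I_3) phi (x : pt) : R := 'D_(delta_mx 0 i) phi x.

Definition grad phi (x : pt) : pt := \row_i partial i phi x.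

Definition jac u (x : pt) : 'M[R]_3 :=
  \matrix_(i, j) partial j (fun y => u y 0 i) x.

Definition eps u (x : pt) : 'M[R]_3 := 2^-1 *: (jac u x + (jac u x)^T).

Definition curl u (x : pt) : pt :=
  let d j i := jac u x (inord i) (inord j) in
  row3 (d 1%N 2%N - d 2%N 1%N) (d 2%N 0%N - d 0%N 2%N) (d 0%N 1%N - d 1%N 0%N).

Fixpoint Cn (n : nat) phi : Prop :=
  if n is m.+1 then
    forall i : 'I_3, (forall x, derivable phi x (delta_mx 0 i)) /\
                     Cn m (partial i phi)
  else continuous phi.

Definition support phi : set pt := closure [set x | phi x != 0].

Definition test_fun phi : Prop := (forall n, Cn n phi) /\ compact (support phi).

Definition weak_div Om u (d : pt -> R) : Prop :=
  L2 Om d /\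
  forall phi, test_fun phi -> support phi `<=` Om ->
    integral3 Om (fun x => dot (u x) (grad phi x)) =
    (- integral3 Om (fun x => d x * phi x)%R)%E.

(* The normal trace is the functional
     phi |-> \int_Om u . grad phi + (div u) phi;
   it vanishes on GD if it kills the test functions that vanish almost
   everywhere on the rest of the boundary. *)
Definition normal_trace0 Om GD u (d : pt -> R) : Prop :=
  forall phi, test_fun phi ->
    hausdorff2 ((boundary Om `\` GD) `&` [set x | phi x != 0]) = 0%E ->
    integral3 Om (fun x => dot (u x) (grad phi x) + d x * phi x) = 0%E.

Definition H0D_div Om GD u : Prop :=
  (forall i : 'I_3, L2 Om (fun x => u x 0 i)) /\
  exists d, weak_div Om u d /\ normal_trace0 Om GD u d.

Definition P1_on (A : set pt) u : Prop :=
  exists (M : 'M[R]_3) (b : pt), forall x, A x -> u x = x *m M + b.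

End Analysis.

(* Elements are sets of 4 vertex indices, facets are sets of 3. *)
Record mesh (R : realType) := Mesh {
  nvert : nat;
  vert : 'I_nvert -> 'rV[R]_3;
  elts : {set {set 'I_nvert}} }.

Section Mesh.
Context {R : realType}.
Notation pt := 'rV[R]_3.
Variable M : mesh R.
Notation ix := 'I_(nvert M).
Implicit Types (S T F : {set ix}) (u v : pt -> pt) (Om GD GN : set pt).

Definition hull S : set pt :=
  [set x | exists l : ix -> R,
    [/\ forall i, 0 <= l i, forall i, i \notin S -> l i = 0,
        \sum_i l i = 1 & x = \sum_i l i *: vert i]].

Definition open_simplex S : set pt :=
  [set x | exists l : ix -> R,
    [/\ forall i, i \in S -> 0 < l i, forall i, i \notin S -> l i = 0,
        \sum_i l i = 1 & x = \sum_i l i *: vert i]].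

Definition affinely_independent S : Prop :=
  forall l : ix -> R, (forall i, i \notin S -> l i = 0) ->
    \sum_i l i = 0 -> \sum_i l i *: vert i = 0 -> forall i, l i = 0.

Definition facets : {set {set ix}} :=
  [set F : {set ix} | (#|F| == 3) && [exists T in elts M, F \subset T]].

(* Inclusion of a facet in a part of the boundary is tested on its relative
   interior, so that it does not matter which of the two parts contains their
   interface. *)
Definition facets_in (G : set pt) : {set {set ix}} :=
  [set F in facets | `[< open_simplex F `<=` G >]].

Definition interior_facets GD GN : {set {set ix}} :=
  facets :\: (facets_in GD :|: facets_in GN).

Definition facets0D GD GN : {set {set ix}} :=
  interior_facets GD GN :|: facets_in GD.

Definition triangulation Om GD GN : Prop :=
  [/\ injective (@vert R M),
      forall T, T \in elts M -> #|T| = 4 /\ affinely_independent T,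
      closure Om = \bigcup_(T in [set` elts M]) hull T,
      forall T T', T \in elts M -> T' \in elts M ->
        hull T `&` hull T' = hull (T :&: T') &
      forall F, F \in facets -> open_simplex F `<=` boundary Om ->
        F \in facets_in GD :|: facets_in GN].

Definition meshsize : R := \big[Num.max/0]_(T in elts M) diam (hull T).

Definition shape_regular (sigma : R) : Prop :=
  forall T, T \in elts M -> diam (hull T) <= sigma * inradius (hull T).

Definition quasiuniform (kappa : R) : Prop :=
  forall T, T \in elts M -> meshsize <= kappa * diam (hull T).

Definition elt_trace T u (x : pt) : pt :=
  lim (u @ within (interior (hull T)) (nbhs x)).

(* The order of the two adjacent elements only affects the sign. *)
Definition jump u F (x : pt) : pt :=
  match enum [set T in elts M | F \subset T] with
  | [:: T1, T2 & _] => elt_trace T1 u x - elt_trace T2 u x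
  | [:: T] => elt_trace T u x
  | _ => 0
  end.

Definition fvert F (k : nat) : pt := [seq vert i | i <- enum F]`_k.

(* The order of the vertices only affects the sign. *)
Definition normal F : pt :=
  let w := cross (fvert F 1 - fvert F 0) (fvert F 2 - fvert F 0) in
  (enorm w)^-1 *: w.

Definition normal_part F u (x : pt) : R := dot (u x) (normal F).

Definition tangential_part F u (x : pt) : pt :=
  u x - normal_part F u x *: normal F.

Definition integral_facet F (f : pt -> R) : \bar R :=
  surface_integral (fvert F 0) (fvert F 1) (fvert F 2) f.

Definition L2_proj F (V : set (pt -> pt)) u : pt -> pt :=
  xget (fun=> 0) [set p | V p /\
    forall q, V q -> integral_facet F (fun x => dot (u x - p x) (q x)) = 0%E].

Definition Pi0 F : (pt -> pt) -> pt -> pt :=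
  L2_proj F [set p | exists a, p = fun=> a].

Definition PiR F : (pt -> pt) -> pt -> pt :=
  L2_proj F [set p | exists t (alpha : R), dot t (normal F) = 0 /\
    p = fun x => t + alpha *: cross (normal F) x].

(* Integrals over elements are taken over their topological interiors, where
   the fields of Vh are smooth. *)
Definition sqnorm_eps u : \bar R :=
  (\sum_(T in elts M) integral3 (interior (hull T))
     (fun x => \sum_(i < 3) \sum_(j < 3) eps u x i j ^+ 2)%R)%E.

Definition sqnorm_facets (E : {set {set ix}}) (f : {set ix} -> pt -> R) : \bar R :=
  (\sum_(F in E) integral_facet F (fun x => f F x ^+ 2)%R)%E.

Definition Vh Om GD u : Prop :=
  H0D_div Om GD u /\
  forall T, T \in elts M -> P1_on (interior (hull T)) u.

End Mesh.

(* Main.v *)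
Require Import Defs.
From mathcomp Require Import all_boot all_order all_algebra.
From mathcomp Require Import all_classical all_reals all_analysis.
From mathcomp Require Import measurable_realfun ring lra.
Import Order.TTheory GRing.Theory Num.Theory.
Import numFieldNormedType.Exports.
Local Open Scope classical_set_scope.
Local Open Scope ring_scope.
Set Implicit Arguments.
Unset Strict Implicit.

(** The equivalence already holds on each facet, up to the strain energy of the
    adjacent elements.

    On a facet F with unit normal n and centroid x_F, the jump of u is an affine
    field x |-> x D + b, where D is the difference of the (transposed) gradients
    of u on the two adjacent elements, or the gradient itself on the boundary.
    The projection onto constants of its tangential part is the value v at x_F,
    and the projection onto R_F is v + k cross(n, x - x_F) for some number k. The two
    summands are orthogonal, so that the squared norms of the two projections
    differ by k^2 times the polar moment of F, which is of order h^2 |F|.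

    Split D into its symmetric and skew parts. The skew part acts as the cross
    product with half the curl, and its contribution to k is exactly c / 2, where
    c is the normal component of the jump of the curl. The symmetric part is the
    jump of the strain and contributes at most its Frobenius norm
    (facet_integrals). Hence k^2 and c^2 control each other up to the squared
    jump of the strain. Multiplied by h |F|, the latter is bounded by the strain
    energy of the adjacent elements (facet_estimates), because strains are
    constant on elements. Summing over the facets gives the theorem, each element
    having boundedly many facets.

    Besides the bound h on all diameters, the only geometric input is that each
    element contains a ball whose radius is comparable to h (inscribed_ball). It bounds the volume of the element
    (integral3_interior_ge) and the edges of its facets (facet_edge_energy) from
    below, and makes every point of the element a limit of interior points, so
    that the traces in the jumps are those of affine fields
    (elt_trace_affine). *)

(** * Vectors and matrices in dimension 3 *)

Section Vectors.
Context {R : realType}.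
Implicit Types (u v w n e : 'rV[R]_3) (D : 'M[R]_3) (a b c k : R).

Lemma sum3 (V : nmodType) (f : 'I_3 -> V) :
  \sum_i f i = f (inord 0) + f (inord 1) + f (inord 2).
Proof.
rewrite !big_ord_recl big_ord0 addr0 addrA.
by congr (f _ + f _ + f _); apply/val_inj; rewrite /= inordK.
Qed.

Lemma row3_0 a b c : row3 a b c 0 (inord 0) = a.
Proof. by rewrite mxE inordK. Qed.
Lemma row3_1 a b c : row3 a b c 0 (inord 1) = b.
Proof. by rewrite mxE inordK. Qed.
Lemma row3_2 a b c : row3 a b c 0 (inord 2) = c.
Proof. by rewrite mxE inordK. Qed.

Lemma row3P u v : u 0 (inord 0) = v 0 (inord 0) -> u 0 (inord 1) = v 0 (inord 1) ->
  u 0 (inord 2) = v 0 (inord 2) -> u = v.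
Proof.
move=> e0 e1 e2; apply/rowP => i.
by rewrite -(inord_val i); case: i => [[|[|[|//]]] ?].
Qed.

Definition coordE := (sum3, row3_0, row3_1, row3_2, mxE).

(** The curl of the field [x |-> x *m D]. Points are row vectors, so that [D] is the
    transposed Jacobian matrix. *)
Definition curl_mx D : 'rV[R]_3 :=
  let d j i := D (inord j) (inord i) in
  row3 (d 1%N 2%N - d 2%N 1%N) (d 2%N 0%N - d 0%N 2%N) (d 0%N 1%N - d 1%N 0%N).

Definition sym_mx D : 'M[R]_3 := 2^-1 *: (D + D^T).

(** The squared Frobenius norm. *)
Definition frob2 D : R := \sum_(i < 3) \sum_(j < 3) D i j ^+ 2.

Lemma dotC u v : dot u v = dot v u.
Proof. by rewrite /dot; apply: eq_bigr => i _; rewrite mulrC. Qed.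

Lemma dotDl u v w : dot (u + v) w = dot u w + dot v w.
Proof. by rewrite /dot -big_split; apply: eq_bigr => i _; rewrite mxE mulrDl. Qed.

Lemma dotZl k u w : dot (k *: u) w = k * dot u w.
Proof. by rewrite /dot mulr_sumr; apply: eq_bigr => i _; rewrite mxE mulrA. Qed.

Lemma dotNl u w : dot (- u) w = - dot u w.
Proof. by rewrite -scaleN1r dotZl mulN1r. Qed.

Lemma dotDr u v w : dot w (u + v) = dot w u + dot w v.
Proof. by rewrite !(dotC w) dotDl. Qed.

Lemma dotZr k u w : dot w (k *: u) = k * dot w u.
Proof. by rewrite !(dotC w) dotZl. Qed.

Lemma dotNr u w : dot w (- u) = - dot w u.
Proof. by rewrite !(dotC w) dotNl. Qed.

Lemma dot0l u : dot 0 u = 0.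
Proof. by rewrite -(scale0r 0) dotZl mul0r. Qed.

Lemma dot0r u : dot u 0 = 0.
Proof. by rewrite dotC dot0l. Qed.

Definition dotE := (dotDl, dotDr, dotNl, dotNr, dotZl, dotZr).

Lemma dot_ge0 u : 0 <= dot u u.
Proof. by apply: sumr_ge0 => i _; rewrite -expr2 sqr_ge0. Qed.

Lemma dot_eq0 u : (dot u u == 0) = (u == 0).
Proof.
apply/eqP/eqP => [/eqP|->]; last exact: dot0l.
rewrite psumr_eq0; last by move=> i _; rewrite -expr2 sqr_ge0.
move=> /allP u0; apply/rowP => i; rewrite mxE.
by have := u0 i (mem_index_enum _); rewrite /= mulf_eq0 orbb => /eqP.
Qed.

Lemma enorm_ge0 u : 0 <= enorm u.
Proof. exact: sqrtr_ge0. Qed.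

Lemma enorm_sqr u : enorm u ^+ 2 = dot u u.
Proof. exact/sqr_sqrtr/dot_ge0. Qed.

Lemma enorm_eq0 u : (enorm u == 0) = (u == 0).
Proof. by rewrite -sqrf_eq0 enorm_sqr dot_eq0. Qed.

Lemma cross0 u : cross 0 u = 0.
Proof. by apply: row3P; rewrite !coordE; ring. Qed.

Lemma crossDr u v w : cross w (u + v) = cross w u + cross w v.
Proof. by apply: row3P; rewrite !coordE; ring. Qed.

Lemma crossZr k u w : cross w (k *: u) = k *: cross w u.
Proof. by apply: row3P; rewrite !coordE; ring. Qed.

Lemma crossNr u w : cross w (- u) = - cross w u.
Proof. by rewrite -scaleN1r crossZr scaleN1r. Qed.

Lemma dot_cross_l u v : dot u (cross u v) = 0.
Proof. by rewrite /dot !coordE; ring. Qed.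

Lemma dot_cross_r u v : dot v (cross u v) = 0.
Proof. by rewrite /dot !coordE; ring. Qed.

Lemma dot_cross_cross u v w e :
  dot (cross u v) (cross w e) = dot u w * dot v e - dot u e * dot v w.
Proof. by rewrite /dot !coordE; ring. Qed.

Lemma dot_cross_normal n e : dot n n = 1 -> dot n e = 0 ->
  dot (cross n e) (cross n e) = dot e e.
Proof. by move=> nn ne; rewrite dot_cross_cross nn ne mul1r mul0r subr0. Qed.

Lemma cross_bound u v a : 0 <= a -> enorm u <= a -> enorm v <= a ->
  enorm (cross u v) <= a ^+ 2.
Proof.
move=> a0 ua va; rewrite -(@ler_pXn2r _ 2) ?nnegrE ?enorm_ge0 ?exprn_ge0 //.
rewrite enorm_sqr dot_cross_cross (dotC v u) -!enorm_sqr.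
apply: (@le_trans _ _ (enorm u ^+ 2 * enorm v ^+ 2)).
  by rewrite lerBlDr lerDl -expr2 sqr_ge0.
rewrite (_ : (a ^+ 2) ^+ 2 = a ^+ 2 * a ^+ 2); last by rewrite expr2.
by apply: ler_pM; rewrite ?exprn_ge0 ?enorm_ge0 // ler_pXn2r ?nnegrE ?enorm_ge0.
Qed.

Lemma frob2_ge0 D : 0 <= frob2 D.
Proof. by apply: sumr_ge0 => i _; apply: sumr_ge0 => j _; rewrite sqr_ge0. Qed.

Lemma frob2_symB D D' :
  frob2 (sym_mx (D - D')) <= 2 * (frob2 (sym_mx D) + frob2 (sym_mx D')).
Proof.
rewrite /frob2 -big_split mulr_sumr; apply: ler_sum => i _.
rewrite -big_split mulr_sumr; apply: ler_sum => j _ /=.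
rewrite !mxE -subr_ge0.
rewrite [X in 0 <= X](_ : _ = (2^-1 * (D i j + D j i) + 2^-1 * (D' i j + D' j i)) ^+ 2).
  exact: sqr_ge0.
by field.
Qed.

Lemma curl_mxB D D' : curl_mx (D - D') = curl_mx D - curl_mx D'.
Proof. by apply: row3P; rewrite !coordE; ring. Qed.

(** The skew part of [D] acts as the cross product with half the curl; paired with
    the rotated vector [cross n e], only the component of the curl along [n]
    survives. *)
Lemma dot_mulmx_cross D n e : dot n n = 1 -> dot n e = 0 ->
  dot (e *m D) (cross n e) =
  dot (e *m sym_mx D) (cross n e) + 2^-1 * dot (curl_mx D) n * dot e e.
Proof.
move=> nn ne.
have -> : e *m D = e *m sym_mx D + 2^-1 *: cross (curl_mx D) e.
  by apply: row3P; rewrite !coordE; field.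
by rewrite dotDl dotZl dot_cross_cross (dotC e n) ne mulr0 subr0 mulrA.
Qed.

Lemma Cauchy_Schwarz_sum (I : finType) (f g : I -> R) :
  (\sum_i f i * g i) ^+ 2 <= (\sum_i f i ^+ 2) * \sum_i g i ^+ 2.
Proof.
set S := \sum_i f i * g i; set A := \sum_i f i ^+ 2; set B := \sum_i g i ^+ 2.
have B0 : 0 <= B by apply: sumr_ge0 => i _; rewrite sqr_ge0.
have [Bz|Bn] := eqVneq B 0.
  rewrite /S big1 ?expr0n ?Bz ?mulr0// => i _.
  move/eqP: Bz; rewrite psumr_eq0 => [/allP/(_ i (mem_index_enum _))|j _];
    last exact: sqr_ge0.
  by rewrite /= sqrf_eq0 => /eqP ->; rewrite mulr0.
have Bp : 0 < B by rewrite lt_neqAle eq_sym Bn.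
rewrite -(ler_pM2l Bp) -subr_ge0.
have -> : B * (A * B) - B * S ^+ 2 = \sum_i (B * f i - S * g i) ^+ 2.
  transitivity (\sum_i (B ^+ 2 * f i ^+ 2 - 2 * B * S * (f i * g i) +
                       S ^+ 2 * g i ^+ 2)).
    by rewrite big_split sumrB -!mulr_sumr -/A -/B -/S /=; ring.
  by apply: eq_bigr => i _; ring.
by apply: sumr_ge0 => i _; rewrite sqr_ge0.
Qed.

(** Cauchy-Schwarz over pairs of indices, the bilinear form being the pairing of [D]
    with the tensor product of [u] and [v]. *)
Lemma bilinear_bound D u v :
  dot (u *m D) v ^+ 2 <= frob2 D * (dot u u * dot v v).
Proof.
have -> : dot (u *m D) v =
    \sum_(p : 'I_3 * 'I_3) D p.1 p.2 * (u 0 p.1 * v 0 p.2).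
  rewrite -(pair_bigA _ (fun i j => D i j * (u 0 i * v 0 j))) exchange_big.
  apply: eq_bigr => j _; rewrite mxE mulr_suml; apply: eq_bigr => i _; ring.
rewrite (_ : frob2 D = \sum_(p : 'I_3 * 'I_3) D p.1 p.2 ^+ 2); last exact: pair_bigA.
rewrite (_ : dot u u * dot v v = \sum_(p : 'I_3 * 'I_3) (u 0 p.1 * v 0 p.2) ^+ 2).
  exact: Cauchy_Schwarz_sum.
rewrite -(pair_bigA _ (fun i j => (u 0 i * v 0 j) ^+ 2)) /dot mulr_suml.
by apply: eq_bigr => i _; rewrite mulr_sumr; apply: eq_bigr => j _; ring.
Qed.

Lemma dot_le_enorm u v : dot u v <= enorm u * enorm v.
Proof.
rewrite (le_trans (ler_norm _)) // -(@ler_pXn2r _ 2) ?nnegrE ?mulr_ge0 ?enorm_ge0 //.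
rewrite real_normK ?num_real // exprMn !enorm_sqr.
have := Cauchy_Schwarz_sum (u 0) (v 0).
by congr (_ <= _ * _); apply: eq_bigr => i _; rewrite expr2.
Qed.

(** Rotation by [n] preserves the length of a tangent vector [e]. *)
Lemma dot_mulmx_cross_bound D n e : dot n n = 1 -> dot n e = 0 ->
  `|dot (e *m D) (cross n e)| <= Num.sqrt (frob2 D) * dot e e.
Proof.
move=> nn ne; rewrite -(@ler_pXn2r _ 2) ?nnegrE //; last first.
  by rewrite mulr_ge0 ?sqrtr_ge0 ?dot_ge0.
rewrite exprMn sqr_sqrtr ?frob2_ge0 // real_normK ?num_real //.
by rewrite (le_trans (bilinear_bound _ _ _)) // dot_cross_normal.
Qed.

End Vectors.

(** * Moments of the reference triangle *)

Section Moments.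
Context {R : realType}.
Local Notation mu := (@lebesgue_measure R).
Local Notation lebesgue2 := (mu \x mu)%E.

Lemma integral_deriv_poly (p : {poly R}) (a b : R) : a <= b ->
  (\int[mu]_(x in `[a, b]) (p^`().[x])%:E = (p.[b] - p.[a])%:E)%E.
Proof.
rewrite le_eqVlt => /predU1P[<-|ab].
  by rewrite set_itv1 integral_set1 subrr.
rewrite (@continuous_FTC2 _ _ (fun x => p.[x])) //.
- by apply/continuous_subspaceT => x; exact: continuous_horner.
- split=> [x _| |].
  + exact: derivable_horner.
  + by apply: cvg_at_right_filter; exact: continuous_horner.
  + by apply: cvg_at_left_filter; exact: continuous_horner.
- by move=> x _; rewrite derivE.
Qed.

Local Notation plane := (measurableTypeR R * measurableTypeR R)%type.

Lemma measurable_ref_triangle :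
  measurable (ref_triangle : set plane).
Proof.
rewrite (_ : ref_triangle = ((fun p : R * R => p.1) @^-1` `[0, +oo[) `&`
  ((fun p : R * R => p.2) @^-1` `[0, +oo[) `&`
  ((fun p : R * R => p.1 + p.2) @^-1` `]-oo, 1])); last first.
  apply/seteqP; split => p /=; rewrite !in_itv /= !andbT.
    by case=> -> -> ->.
  by case=> -[? ?] ?; split.
apply: measurableI; first apply: measurableI.
- by rewrite -[X in measurable X]setTI; exact: measurable_fst.
- by rewrite -[X in measurable X]setTI; exact: measurable_snd.
- rewrite -[X in measurable X]setTI.
  by apply: (measurable_funD measurable_fst measurable_snd).
Qed.

(** Tonelli; the inner integral runs over the section [[0, 1 - s]]. *)
Lemma integral_monomial_triangle i j :
  (\int[lebesgue2]_(p in ref_triangle) (p.1 ^+ i * p.2 ^+ j)%:E =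
   \int[mu]_(s in `[0%R, 1%R]) (s ^+ i * ((1 - s) ^+ j.+1 / j.+1%:R))%:E)%E.
Proof.
pose f := fun p : R * R => (p.1 ^+ i * p.2 ^+ j)%:E.
have mf : measurable_fun setT f.
  apply/measurable_EFinP; apply: measurable_funM.
    exact: measurable_funX measurable_fst.
  exact: measurable_funX measurable_snd.
rewrite integral_mkcond fubini_tonelli1; last 2 first.
- by apply/(measurable_restrictT f measurable_ref_triangle); exact: measurable_funTS.
- move=> p; rewrite patchE; case: ifPn => // /set_mem[p1 p2 _].
  by rewrite lee_fin mulr_ge0 ?exprn_ge0.
rewrite [RHS]integral_mkcond; apply: eq_integral => s0 _.
move: (s0 : R) => {s0} s; rewrite patchE /fubini_F.
case: ifPn => [|]; rewrite ?notin_setE ?inE/= in_itv /=.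
  move=> /andP[s0 s1].
  transitivity (\int[mu]_(t in `[0%R, (1 - s)%R])
    ((((s ^+ i / j.+1%:R) *: 'X^(j.+1) : {poly R})^`()).[t])%R%:E)%E.
    rewrite [RHS]integral_mkcond; apply: eq_integral => t0 _.
    move: (t0 : R) => {t0} t; rewrite !patchE.
    rewrite (_ : (t \in `[0, 1 - s]%classic) = ((s, t) \in ref_triangle)); last first.
      apply/idP/idP; rewrite !inE /= in_itv /=.
        by move=> /andP[t0 ts]; split => //=; lra.
      by case=> /= _ t0 ts; rewrite t0; lra.
    case: ifP => // _; rewrite /f derivZ derivXn hornerZ hornerMn hornerXn /=.
    by congr EFin; rewrite -mulr_natl; field; rewrite addrC natr1 pnatr_eq0.
  rewrite integral_deriv_poly ?subr_ge0 // !hornerZ !hornerXn expr0n /= mulr0 subr0.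
  by congr EFin; rewrite -mulrA; congr (_ * _); rewrite mulrC.
move=> sn; rewrite integral0_eq // => t0 _; move: (t0 : R) => {t0} t; rewrite patchE.
case: ifP => // /set_mem[/= s0 t0 st]; exfalso; apply: sn; rewrite s0; lra.
Qed.

(** Integrability is recorded together with the value, since signed integrands only
    add up when they are integrable. *)
Definition triangle_integral (f : R * R -> R) (v : R) : Prop :=
  lebesgue2.-integrable ref_triangle (EFin \o f) /\
  (\int[lebesgue2]_(p in ref_triangle) (f p)%:E = v%:E)%E.

Lemma triangle_integralD f g a b : triangle_integral f a -> triangle_integral g b ->
  triangle_integral (fun p => f p + g p) (a + b).
Proof.
move=> [fi fE] [gi gE]; split.
  exact: (integrableD measurable_ref_triangle fi gi).
by rewrite (integralD measurable_ref_triangle fi gi) fE gE.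
Qed.

Lemma triangle_integralZ k f a : triangle_integral f a ->
  triangle_integral (fun p => k * f p) (k * a).
Proof.
move=> [fi fE]; split.
  exact: (integrableZl measurable_ref_triangle k fi).
by rewrite (integralZl measurable_ref_triangle fi) fE.
Qed.

(** [q] is a primitive of the function that remains after the inner integration. *)
Lemma triangle_integral_monomial i j (q : {poly R}) v :
  (forall s, (q^`()).[s] = s ^+ i * ((1 - s) ^+ j.+1 / j.+1%:R)) ->
  q.[1] - q.[0] = v ->
  triangle_integral (fun p => p.1 ^+ i * p.2 ^+ j) v.
Proof.
move=> dq <-.
have fE : (\int[lebesgue2]_(p in ref_triangle) (p.1 ^+ i * p.2 ^+ j)%:E =
    (q.[1] - q.[0])%:E)%E.
  rewrite integral_monomial_triangle -integral_deriv_poly //.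
  by apply: eq_integral => s _; rewrite dq.
split => //; apply/integrableP; split.
  apply: measurable_funTS; apply/measurable_EFinP; apply: measurable_funM.
    exact: measurable_funX measurable_fst.
  exact: measurable_funX measurable_snd.
apply: le_lt_trans (ltry (q.[1] - q.[0])); rewrite -fE le_eqVlt; apply/orP; left.
apply/eqP/eq_integral => p /set_mem[p1 p2 _] /=.
by rewrite ger0_norm // mulr_ge0 ?exprn_ge0.
Qed.

Lemma triangle_integral_quadratic (c0 c1 c2 c3 c4 c5 : R) :
  triangle_integral
    (fun p => c0 + c1 * p.1 + c2 * p.2 + c3 * p.1 ^+ 2 + c4 * (p.1 * p.2) +
              c5 * p.2 ^+ 2)
    (c0 / 2 + c1 / 6 + c2 / 6 + c3 / 12 + c4 / 24 + c5 / 12).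
Proof.
have t00 : triangle_integral (fun p => p.1 ^+ 0 * p.2 ^+ 0) 2^-1.
  apply: (@triangle_integral_monomial _ _ ('X - 2^-1 *: 'X^2)).
    by move=> s; rewrite !poly.derivE !hornerE /= ?hornerMn ?hornerE; field.
  by rewrite !hornerE /=; field.
have t10 : triangle_integral (fun p => p.1 ^+ 1 * p.2 ^+ 0) 6^-1.
  apply: (@triangle_integral_monomial _ _ (2^-1 *: 'X^2 - 3^-1 *: 'X^3)).
    by move=> s; rewrite !poly.derivE !hornerE /= ?hornerMn ?hornerE; field.
  by rewrite !hornerE /=; field.
have t01 : triangle_integral (fun p => p.1 ^+ 0 * p.2 ^+ 1) 6^-1.
  apply: (@triangle_integral_monomial _ _ (2^-1 *: 'X - 2^-1 *: 'X^2 + 6^-1 *: 'X^3)).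
    by move=> s; rewrite !poly.derivE !hornerE /= ?hornerMn ?hornerE; field.
  by rewrite !hornerE /=; field.
have t20 : triangle_integral (fun p => p.1 ^+ 2 * p.2 ^+ 0) 12^-1.
  apply: (@triangle_integral_monomial _ _ (3^-1 *: 'X^3 - 4^-1 *: 'X^4)).
    by move=> s; rewrite !poly.derivE !hornerE /= ?hornerMn ?hornerE; field.
  by rewrite !hornerE /=; field.
have t11 : triangle_integral (fun p => p.1 ^+ 1 * p.2 ^+ 1) 24^-1.
  apply: (@triangle_integral_monomial _ _ (4^-1 *: 'X^2 - 3^-1 *: 'X^3 + 8^-1 *: 'X^4)).
    by move=> s; rewrite !poly.derivE !hornerE /= ?hornerMn ?hornerE; field.
  by rewrite !hornerE /=; field.
have t02 : triangle_integral (fun p => p.1 ^+ 0 * p.2 ^+ 2) 12^-1.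
  apply: (@triangle_integral_monomial _ _
    (3^-1 *: 'X - 2^-1 *: 'X^2 + 3^-1 *: 'X^3 - 12^-1 *: 'X^4)).
    by move=> s; rewrite !poly.derivE !hornerE /= ?hornerMn ?hornerE; field.
  by rewrite !hornerE /=; field.
have := triangle_integralD (triangle_integralD (triangle_integralD
  (triangle_integralD (triangle_integralD
  (triangle_integralZ c0 t00) (triangle_integralZ c1 t10)) (triangle_integralZ c2 t01))
  (triangle_integralZ c3 t20)) (triangle_integralZ c4 t11)) (triangle_integralZ c5 t02).
congr triangle_integral; by apply/funext => p; rewrite !expr0 !expr1 !mulr1 !mul1r.
Qed.

(** Expanding affine fields around the barycentre [(1/3, 1/3)] removes the mixed
    terms between constant and linear parts. The second moments there are 1/36 and
    -1/72, which makes the linear part a sum over the three edges of the triangle. *)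
Lemma triangle_integral_dot (a a1 a2 b b1 b2 : 'rV[R]_3) :
  triangle_integral
    (fun p => dot (a + (p.1 - 3^-1) *: a1 + (p.2 - 3^-1) *: a2)
                  (b + (p.1 - 3^-1) *: b1 + (p.2 - 3^-1) *: b2))
    (dot a b / 2 + (dot a1 b1 + dot a2 b2 + dot (a1 - a2) (b1 - b2)) / 72).
Proof.
pose A := a - 3^-1 *: a1 - 3^-1 *: a2; pose B := b - 3^-1 *: b1 - 3^-1 *: b2.
have := triangle_integral_quadratic (dot A B) (dot a1 B + dot A b1) (dot a2 B + dot A b2)
  (dot a1 b1) (dot a1 b2 + dot a2 b1) (dot a2 b2).
congr triangle_integral; last by rewrite /A /B !dotE; field.
by apply/funext => p; rewrite /A /B !dotE; ring.
Qed.

End Moments.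

(** * Projections of an affine field on a facet *)

Section Facet.
Context {R : realType} (M : mesh R) (F : {set 'I_(nvert M)}).
Notation pt := 'rV[R]_3.
Implicit Types (u v w : pt) (f g : pt -> pt) (D : 'M[R]_3).

Definition edge1 : pt := fvert F 1 - fvert F 0.
Definition edge2 : pt := fvert F 2 - fvert F 0.
Definition area_vector : pt := cross edge1 edge2.
Definition centroid : pt := fvert F 0 + 3^-1 *: edge1 + 3^-1 *: edge2.
Definition facet_param (p : R * R) : pt := fvert F 0 + p.1 *: edge1 + p.2 *: edge2.

(** When [u1], [u2] and [v1], [v2] are the values on [edge1], [edge2] of two linear
    maps, this sums the products of their values over the three edges. *)
Definition edge_form u1 u2 v1 v2 : R :=
  dot u1 v1 + dot u2 v2 + dot (u1 - u2) (v1 - v2).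

Definition edge_energy : R := edge_form edge1 edge2 edge1 edge2.

(** Centred at the centroid, so that [v] is the mean of the field. *)
Definition affine_on_facet f v v1 v2 : Prop := forall p, ref_triangle p ->
  f (facet_param p) = v + (p.1 - 3^-1) *: v1 + (p.2 - 3^-1) *: v2.

Lemma facet_param_centroid p :
  facet_param p = centroid + (p.1 - 3^-1) *: edge1 + (p.2 - 3^-1) *: edge2.
Proof. by apply/rowP => i; rewrite !mxE; ring. Qed.

Lemma integral_facet_dot f g (h : pt -> R) v v1 v2 w w1 w2 :
  affine_on_facet f v v1 v2 -> affine_on_facet g w w1 w2 ->
  (forall x, h x = dot (f x) (g x)) ->
  integral_facet F h =
  (enorm area_vector * (dot v w / 2 + edge_form v1 v2 w1 w2 / 72))%:E.
Proof.
move=> fE gE hE; rewrite EFinM; congr (_ * _)%E.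
have [_ <-] := triangle_integral_dot v v1 v2 w w1 w2.
by apply: eq_integral => p /set_mem pF; rewrite hE -/(facet_param p) fE // gE.
Qed.

Lemma integral_facet_degenerate (h : pt -> R) : area_vector = 0 ->
  integral_facet F h = 0%E.
Proof.
rewrite /integral_facet /surface_integral -/edge1 -/edge2 -/area_vector => ->.
by rewrite (_ : enorm 0 = 0) ?mul0e //; apply/eqP; rewrite enorm_eq0.
Qed.

Hypothesis area_vector_neq0 : area_vector != 0.

Let area_gt0 : 0 < enorm area_vector.
Proof. by rewrite lt_neqAle enorm_ge0 eq_sym enorm_eq0 andbT. Qed.

Lemma normal_unit : dot (normal F) (normal F) = 1.
Proof.
rewrite /normal -/edge1 -/edge2 -/area_vector dotZl dotZr -enorm_sqr.
by field; rewrite enorm_eq0.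
Qed.

Lemma normal_edge1 : dot (normal F) edge1 = 0.
Proof. by rewrite /normal dotZl dotC dot_cross_l mulr0. Qed.

Lemma normal_edge2 : dot (normal F) edge2 = 0.
Proof. by rewrite /normal dotZl dotC dot_cross_r mulr0. Qed.

Lemma edge_energy_gt0 : 0 < edge_energy.
Proof.
have e1 : 0 < dot edge1 edge1.
  rewrite lt_neqAle dot_ge0 andbT eq_sym dot_eq0.
  by apply: contra_neq area_vector_neq0 => e0; rewrite /area_vector e0 cross0.
by rewrite /edge_energy /edge_form -addrA ltr_wpDr // addr_ge0 ?dot_ge0.
Qed.

Lemma affine_on_facet_cst v : affine_on_facet (fun=> v) v 0 0.
Proof. by move=> p _; rewrite !scaler0 !addr0. Qed.

Lemma affine_on_facetB f g v v1 v2 w w1 w2 :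
  affine_on_facet f v v1 v2 -> affine_on_facet g w w1 w2 ->
  affine_on_facet (fun x => f x - g x) (v - w) (v1 - w1) (v2 - w2).
Proof.
by move=> fE gE p pF; rewrite fE // gE //; apply/rowP => i; rewrite !mxE; ring.
Qed.

Lemma affine_on_facet_rigid t k :
  affine_on_facet (fun x => t + k *: cross (normal F) x)
    (t + k *: cross (normal F) centroid)
    (k *: cross (normal F) edge1) (k *: cross (normal F) edge2).
Proof.
move=> p _; rewrite facet_param_centroid; move: centroid edge1 edge2 => c e1 e2.
rewrite !crossDr !crossZr; by rewrite !scalerDr !scalerA !addrA !(mulrC k).
Qed.

Lemma integral_facet_eq0 f g v v1 v2 w w1 w2 :
  affine_on_facet f v v1 v2 -> affine_on_facet g w w1 w2 ->
  integral_facet F (fun x => dot (f x) (g x)) = 0%E <->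
  dot v w / 2 + edge_form v1 v2 w1 w2 / 72 = 0.
Proof.
move=> fE gE; rewrite (integral_facet_dot fE gE) //; split=> [[/eqP]|->].
  by rewrite mulf_eq0 gt_eqF //= => /eqP.
by rewrite mulr0.
Qed.

(** The constant [v] satisfies the orthogonality relations. Conversely, testing them
    with the difference of [v] and a solution [a] gives [a = v]. *)
Lemma Pi0_affine f v v1 v2 : affine_on_facet f v v1 v2 -> Pi0 F f = fun=> v.
Proof.
move=> fE; rewrite /Pi0 /L2_proj.
case: xgetP => [_ -> [[a ->] orth]|/(_ (fun=> v)) []]; last first.
  split=> [|_ [a ->]]; first by exists v.
  apply/(integral_facet_eq0 (affine_on_facetB fE (affine_on_facet_cst v))
    (affine_on_facet_cst a)).
  by rewrite /edge_form subrr subr0 !dotE !dot0l !(dotC _ 0) !dot0l; field.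
have := orth (fun=> v - a) (ex_intro _ _ erefl).
move/(integral_facet_eq0 (affine_on_facetB fE (affine_on_facet_cst a))
  (affine_on_facet_cst (v - a))).
rewrite /edge_form !subr0 !(dotC _ 0) !dot0l !addr0 mul0r addr0 => /eqP.
by rewrite mulf_eq0 invr_eq0 pnatr_eq0 orbF dot_eq0 subr_eq0 => /eqP ->.
Qed.

(** Testing the orthogonality relations with the constant tangential field
    [v - p centroid], for a solution [p], fixes the value of [p] at the centroid;
    testing them with [x |-> cross n x] then fixes the coefficient of rotation. *)
Lemma PiR_affine f v v1 v2 : affine_on_facet f v v1 v2 ->
  dot v (normal F) = 0 ->
  exists k, PiR F f = (fun x => (v - k *: cross (normal F) centroid) +
                                k *: cross (normal F) x) /\
    k * edge_energy =
    edge_form v1 v2 (cross (normal F) edge1) (cross (normal F) edge2).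
Proof.
set n := normal F => fE vn.
have energyE : edge_form (cross n edge1) (cross n edge2)
    (cross n edge1) (cross n edge2) = edge_energy.
  move: normal_unit normal_edge1 normal_edge2; rewrite /edge_energy -/n.
  move: edge1 edge2 => e1 e2 nn ne1 ne2; rewrite /edge_form -crossNr -crossDr.
  by rewrite !dot_cross_normal // dotDr dotNr ne1 ne2 subrr.
have formZr k u1 u2 w1 w2 :
    edge_form u1 u2 (k *: w1) (k *: w2) = k * edge_form u1 u2 w1 w2.
  by rewrite /edge_form -scalerBr !dotZr -!mulrDr.
have formBl u1 u2 k w1 w2 : edge_form (u1 - k *: w1) (u2 - k *: w2) w1 w2 =
    edge_form u1 u2 w1 w2 - k * edge_form w1 w2 w1 w2.
  by rewrite /edge_form !dotE; ring.
rewrite /PiR /L2_proj; case: xgetP => [_ -> [[t [k [tn ->]]] orth]|].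
  exists k.
  pose d := v - (t + k *: cross n centroid).
  have dn : dot d n = 0.
    rewrite /d dotDl dotNl dotDl dotZl vn tn (dotC _ n) dot_cross_l.
    by rewrite mulr0 !addr0 oppr0 addr0.
  have fB := affine_on_facetB fE (affine_on_facet_rigid t k).
  have d0 : d = 0.
    have dV : exists t (a : R), dot t n = 0 /\
        (fun=> d) = (fun x : pt => t + a *: cross n x).
      by exists d, 0; split=> //; apply/funext => x; rewrite scale0r addr0.
    move/(integral_facet_eq0 fB (affine_on_facet_cst d)): (orth _ dV).
    rewrite /edge_form !subr0 !(dotC _ 0) !dot0l !addr0 mul0r addr0 => /eqP.
    by rewrite mulf_eq0 invr_eq0 pnatr_eq0 orbF dot_eq0 => /eqP.
  have cV : exists t (a : R), dot t n = 0 /\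
      (fun x : pt => 0 + 1 *: cross n x) = (fun x : pt => t + a *: cross n x).
    by exists 0, 1; rewrite dot0l.
  move/(integral_facet_eq0 fB (affine_on_facet_rigid 0 1)): (orth _ cV).
  rewrite -/n -/d d0 dot0l mul0r add0r !scale1r formBl energyE => /eqP.
  rewrite mulf_eq0 invr_eq0 pnatr_eq0 orbF subr_eq0 => /eqP <-; split=> //.
  apply/funext => x; congr (_ + _).
  by apply/eqP; rewrite eq_sym subr_eq; rewrite -subr_eq0; apply/eqP.
set e := edge_form v1 v2 (cross n edge1) (cross n edge2).
move/(_ (fun x => (v - e / edge_energy *: cross n centroid) +
  e / edge_energy *: cross n x)) => -[]; split.
  exists (v - e / edge_energy *: cross n centroid), (e / edge_energy).
  by rewrite dotDl dotNl dotZl vn (dotC _ n) dot_cross_l mulr0 oppr0 addr0.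
move=> _ [t [a [_ ->]]].
apply/(integral_facet_eq0 (affine_on_facetB fE (affine_on_facet_rigid _ _))
  (affine_on_facet_rigid t a)).
rewrite -/n subrK subrr dot0l mul0r add0r formZr formBl energyE -/e.
by rewrite divfK ?subrr ?mulr0 ?mul0r // gt_eqF // edge_energy_gt0.
Qed.

(** The contribution of the skew part of [D] to the coefficient of rotation. *)
Lemma edge_form_curl D (n := normal F) :
  edge_form (edge1 *m D) (edge2 *m D) (cross n edge1) (cross n edge2) =
  edge_form (edge1 *m sym_mx D) (edge2 *m sym_mx D) (cross n edge1) (cross n edge2) +
  2^-1 * dot (curl_mx D) n * edge_energy.
Proof.
move: normal_unit normal_edge1 normal_edge2; rewrite /edge_energy -/n.
move: edge1 edge2 => e1 e2 nn ne1 ne2.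
have ne12 : dot n (e1 - e2) = 0 by rewrite dotDr dotNr ne1 ne2 subrr.
rewrite /edge_form -!mulmxBl -crossNr -crossDr.
by rewrite !(dot_mulmx_cross D nn) //; ring.
Qed.

(** Applied to symmetric parts, this bounds the contribution of the strain. *)
Lemma edge_form_bound D (n := normal F) :
  `|edge_form (edge1 *m D) (edge2 *m D) (cross n edge1) (cross n edge2)| <=
  Num.sqrt (frob2 D) * edge_energy.
Proof.
move: normal_unit normal_edge1 normal_edge2; rewrite /edge_energy -/n.
move: edge1 edge2 => e1 e2 nn ne1 ne2.
have ne12 : dot n (e1 - e2) = 0 by rewrite dotDr dotNr ne1 ne2 subrr.
rewrite /edge_form -mulmxBl -crossNr -crossDr !mulrDr.
apply: (le_trans (ler_normD _ _)); apply: lerD; last exact: dot_mulmx_cross_bound.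
by apply: (le_trans (ler_normD _ _)); apply: lerD; exact: dot_mulmx_cross_bound.
Qed.

(** Here [f] stands for the jump of a piecewise affine field and [g] for the jump of
    its curl; [k] is the coefficient of rotation of the projection onto rigid
    motions, and [c] the normal component of the curl. *)
Lemma facet_integrals f g D b :
  (forall p, ref_triangle p -> f (facet_param p) = facet_param p *m D + b) ->
  (forall p, ref_triangle p -> g (facet_param p) = curl_mx D) ->
  exists q k c : R, [/\ 0 <= q, `|k - c / 2| <= Num.sqrt (frob2 (sym_mx D)),
    integral_facet F (fun x => enorm (PiR F (tangential_part F f) x) ^+ 2) =
      (q + enorm area_vector * edge_energy / 72 * k ^+ 2)%:E,
    integral_facet F (fun x => enorm (Pi0 F (tangential_part F f) x) ^+ 2) = q%:E &
    integral_facet F (fun x => normal_part F g x ^+ 2) =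
      (enorm area_vector / 2 * c ^+ 2)%:E].
Proof.
move=> fE gE; set n := normal F.
have nn : dot n n = 1 := normal_unit.
pose P v := v - dot v n *: n.
have Pn v : dot (P v) n = 0 by rewrite /P dotDl dotNl dotZl nn mulr1 subrr.
have PD u v : P (u + v) = P u + P v.
  by rewrite /P dotDl scalerDl opprD addrACA.
have PZ k v : P (k *: v) = k *: P v by rewrite /P dotZl scalerBr -(scalerA k).
have PB u v : P u - P v = P (u - v).
  by rewrite PD -(scaleN1r v) PZ scaleN1r.
have tE : affine_on_facet (tangential_part F f) (P (centroid *m D + b))
    (P (edge1 *m D)) (P (edge2 *m D)).
  move=> p pF; rewrite /tangential_part /normal_part -/n -/(P _) fE //.
  rewrite -!PZ -!PD; congr P; rewrite facet_param_centroid.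
  move: centroid edge1 edge2 => x e1 e2; rewrite !mulmxDl -!scalemxAl.
  by rewrite -!addrA; congr (_ + _); rewrite addrA addrC.
have [k [PiRE kE]] := PiR_affine tE (Pn _).
have Pcross u v : dot (P u) (cross n v) = dot u (cross n v).
  by rewrite /P dotDl dotNl dotZl dot_cross_l mulr0 subr0.
have {}kE : k * edge_energy = edge_form (edge1 *m D) (edge2 *m D)
    (cross n edge1) (cross n edge2).
  rewrite kE -/n; move: edge1 edge2 => e1 e2.
  by rewrite /edge_form PB -crossNr -crossDr !Pcross.
set c := dot (curl_mx D) n.
pose v0 := P (centroid *m D + b).
exists (enorm area_vector * (dot v0 v0 / 2)), k, c; split.
- by rewrite mulr_ge0 ?divr_ge0 ?dot_ge0 ?enorm_ge0 ?ler0n.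
- rewrite -(ler_pM2r edge_energy_gt0).
  apply: le_trans (edge_form_bound (sym_mx D)).
  rewrite -{1}(gtr0_norm edge_energy_gt0) -normrM mulrBl kE (edge_form_curl D) -/n -/c.
  by rewrite (mulrC c) addrK.
- have RE : affine_on_facet (PiR F (tangential_part F f)) v0
      (k *: cross n edge1) (k *: cross n edge2).
    by move=> p pF; rewrite PiRE affine_on_facet_rigid // subrK.
  rewrite (integral_facet_dot RE RE) => [|x]; last exact: enorm_sqr.
  congr EFin; rewrite mulrDr; congr (_ + _).
  have -> : edge_form (k *: cross n edge1) (k *: cross n edge2)
      (k *: cross n edge1) (k *: cross n edge2) = k ^+ 2 * edge_energy.
    move: normal_edge1 normal_edge2; rewrite /edge_energy -/n.
    move: edge1 edge2 => e1 e2 ne1 ne2.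
    have ne12 : dot n (e1 - e2) = 0 by rewrite dotDr dotNr ne1 ne2 subrr.
    rewrite /edge_form -scalerBr -crossNr -crossDr !dotZl !dotZr.
    by rewrite !dot_cross_normal //; ring.
  by field.
- rewrite (Pi0_affine tE).
  rewrite (integral_facet_dot (affine_on_facet_cst v0) (affine_on_facet_cst v0)).
    by rewrite /edge_form subr0 !dot0l !addr0 mul0r addr0.
  by move=> x; rewrite enorm_sqr.
- have gE' : affine_on_facet (fun x => normal_part F g x *: n) (c *: n) 0 0.
    by move=> p pF; rewrite /normal_part gE // !scaler0 !addr0.
  rewrite (integral_facet_dot gE' gE') => [|x].
    rewrite /edge_form subr0 !dot0l !addr0 mul0r addr0 dotZl dotZr nn.
    by congr EFin; field.
  by rewrite dotZl dotZr nn mulr1 expr2.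
Qed.

End Facet.

(** * Traces and derivatives of locally affine fields *)

Section Affine.
Context {R : realType}.
Notation pt := 'rV[R]_3.
Implicit Types (u : pt -> pt) (A : 'M[R]_3) (b x y : pt) (I : set pt).

Lemma continuous_affine A b : continuous (fun x : pt => x *m A + b).
Proof.
have cA : continuous (fun x : pt => \sum_i x 0 i *: row i A).
  move=> x; apply: (@cvg_big _ _ _ _ _ (@add_continuous pt) _ (nbhs x)) => i _.
  exact: (cvgZl (@coord_continuous R 1 3 0 i x)).
move=> x; rewrite /continuous_at.
under eq_fun do rewrite mulmx_sum_row.
rewrite mulmx_sum_row.
exact: (cvgD (cA x) (cvg_cst b)).
Qed.

Lemma derive_affine A b (i j : 'I_3) x :
  'D_(delta_mx 0 j) (fun y : pt => (y *m A + b) 0 i : R) x = A j i.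
Proof.
rewrite /derive; apply/cvg_lim; first exact: norm_hausdorff.
apply: cvg_near_cst; near=> h.
rewrite /= mulmxDl -scalemxAl -rowE.
rewrite (_ : (_ - _ : R) = h * A j i); last by rewrite !mxE; ring.
rewrite -[LHS]/(h^-1 * (h * A j i)) mulrA mulVf ?mul1r //.
by near: h; exact: nbhs_dnbhs_neq.
Unshelve. all: by end_near. Qed.

Lemma jac_affine u A b I x : open I -> I x ->
  (forall y, I y -> u y = y *m A + b) -> jac u x = A^T.
Proof.
move=> oI Ix uE; apply/matrixP => i j; rewrite !mxE /partial.
rewrite -(derive_affine A b i j x); apply: near_eq_derive.
by near=> y; rewrite uE //; near: y; exact: open_nbhs_nbhs.
Unshelve. all: by end_near. Qed.

Lemma eps_affine u A b I x : open I -> I x ->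
  (forall y, I y -> u y = y *m A + b) -> eps u x = sym_mx A.
Proof.
by move=> oI Ix uE; rewrite /eps (jac_affine oI Ix uE) trmxK addrC.
Qed.

Lemma curl_affine u A b I x : open I -> I x ->
  (forall y, I y -> u y = y *m A + b) -> curl u x = curl_mx A.
Proof. by move=> oI Ix uE; rewrite /curl (jac_affine oI Ix uE) /= !mxE. Qed.

(** The affine extension is continuous, hence is the limit from inside [I]. *)
Lemma lim_within_affine u A b I x : closure I x ->
  (forall y, I y -> u y = y *m A + b) ->
  lim (u @ within I (nbhs x)) = x *m A + b.
Proof.
move=> clI uE; have PF := within_nbhs_proper clI.
apply/cvg_lim; first exact: norm_hausdorff.
apply: (@cvg_trans _ ((fun y => y *m A + b) @ within I (nbhs x))); last first.
  exact: (cvg_within_filter I (@continuous_affine A b x)).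
apply: near_eq_cvg.
by apply: (filterS _ (withinT I (nbhs_filter x))) => y Iy; rewrite uE.
Qed.

End Affine.

(** The integral of a nonnegative function is a supremum over simple functions, so
    that [B] and [f] may be arbitrary. *)
Lemma integral_ge_cst d (T : measurableType d) (R : realType)
    (mu : {measure set T -> \bar R}) (A B : set T) (f : T -> \bar R) (k : R) :
  measurable A -> A `<=` B -> 0 <= k ->
  (forall x, B x -> 0 <= f x)%E -> (forall x, A x -> k%:E <= f x)%E ->
  (k%:E * mu A <= \int[mu]_(x in B) f x)%E.
Proof.
move=> mA AB k0 f0 kf; rewrite -integral_cst // !ge0_integralE //.
apply: ereal_sup_le => _ [h /= hle <-]; exists h => //= x.
apply: le_trans (hle x) _; rewrite !patchE; case: ifPn => [/set_mem xA|_].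
  by rewrite mem_set ?kf //; exact: AB.
by case: ifPn => // /set_mem /f0.
Qed.

(** * Simplices containing a ball *)

Section Hull.
Context {R : realType} (M : mesh R).
Notation pt := 'rV[R]_3.
Notation ix := 'I_(nvert M).
Implicit Types (S T F : {set ix}) (x y c v : pt) (r m : R).

Lemma hull_convex S x y t : hull S x -> hull S y -> 0 <= t <= 1 ->
  hull S ((1 - t) *: x + t *: y).
Proof.
move=> [l [l0 lS l1 ->]] [k [k0 kS k1 ->]] /andP[t0 t1].
exists (fun i => (1 - t) * l i + t * k i); split.
- by move=> i; rewrite addr_ge0 ?mulr_ge0 ?subr_ge0.
- by move=> i iS; rewrite lS // kS // !mulr0 addr0.
- by rewrite big_split /= -!mulr_sumr l1 k1; ring.
- rewrite !scaler_sumr -big_split; apply: eq_bigr => i _ /=.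
  by rewrite !scalerA -scalerDl.
Qed.

Lemma hull_vert S i : i \in S -> hull S (@vert _ M i).
Proof.
move=> iS; exists (fun j => (j == i)%:R); split.
- by move=> j; exact: ler0n.
- by move=> j jS; case: eqP => // ji; rewrite ji iS in jS.
- by rewrite (bigD1 i) //= eqxx big1 ?addr0 // => j /negbTE ->.
- rewrite (bigD1 i) //= eqxx scale1r big1 ?addr0 // => j /negbTE ->.
  by rewrite scale0r.
Qed.

Lemma hullS S T : S \subset T -> hull S `<=` @hull _ M T.
Proof.
move=> /fintype.subsetP ST x [l [l0 lS l1 ->]]; exists l; split=> // i iT.
by apply: lS; apply: contra iT; exact: ST.
Qed.

(** A linear functional attains its maximum over a simplex at a vertex. *)
Lemma hull_dot_le T v c m x : (forall i, i \in T -> dot v (vert i - c) <= m) ->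
  hull T x -> dot v (x - c) <= m.
Proof.
move=> vm [l [l0 lT l1 ->]].
have -> : \sum_i l i *: vert i - c = \sum_i l i *: (vert i - c).
  by under [RHS]eq_bigr do rewrite scalerBr; rewrite sumrB -scaler_suml l1 scale1r.
have -> : dot v (\sum_i l i *: (vert i - c)) = \sum_i l i * dot v (vert i - c).
  rewrite (big_morph (dot v) (fun a b => dotDr a b v) (dot0r v)).
  by apply: eq_bigr => i _; rewrite dotZr.
rewrite -[leRHS]mul1r -l1 mulr_suml; apply: ler_sum => i _.
have [iT|iT] := boolP (i \in T); first by rewrite ler_wpM2l // vm.
by rewrite lT // !mul0r.
Qed.

(** The squared distance is the value at [x - y] of the linear functional
    [dot (x - y)], to which [hull_dot_le] applies. *)
Lemma hull_dist_le T y m x : 0 <= m ->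
  (forall i, i \in T -> enorm (vert i - y) <= m) -> hull T x -> enorm (x - y) <= m.
Proof.
move=> m0 vm xT; have [->|xy] := eqVneq (x - y) 0.
  by rewrite (_ : enorm 0 = 0) //; apply/eqP; rewrite enorm_eq0.
have xy0 : 0 < enorm (x - y) by rewrite lt_neqAle enorm_ge0 eq_sym enorm_eq0 xy.
rewrite -(ler_pM2l xy0) -expr2 enorm_sqr; apply: hull_dot_le xT => i iT.
by rewrite (le_trans (dot_le_enorm _ _)) // ler_wpM2l ?enorm_ge0 // vm.
Qed.

Lemma hull_diam T x y : hull T x -> hull T y -> enorm (x - y) <= diam (@hull _ M T).
Proof.
move=> xT yT; apply: ub_le_sup; last by exists x => //; exists y.
pose m := \sum_(i : ix) \sum_(j : ix) enorm (@vert _ M i - vert j).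
have m0 : 0 <= m by do 2!(apply: sumr_ge0 => ? _); exact: enorm_ge0.
have vm (i j : ix) : enorm (@vert _ M i - vert j) <= m.
  apply: (@le_trans _ _ (\sum_(j : ix) enorm (@vert _ M i - vert j))).
    rewrite (bigD1 j) //= lerDl; apply: sumr_ge0 => ? _; exact: enorm_ge0.
  rewrite /m [leRHS](bigD1 i) //= lerDl.
  by do 2!(apply: sumr_ge0 => ? _); exact: enorm_ge0.
have enormB (a b : pt) : enorm (a - b) = enorm (b - a) :> R.
  by rewrite /enorm !dotE; congr Num.sqrt; ring.
exists m => _ [a aT [b bT <-]].
apply: hull_dist_le aT => // i iT; rewrite enormB.
by apply: hull_dist_le bT => // j jT.
Qed.

Lemma diam_le_meshsize T : T \in elts M -> diam (@hull _ M T) <= meshsize M.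
Proof.
move=> TM; rewrite /meshsize.
by rewrite (Order.TotalTheory.le_bigmax_cond _ (fun T => diam (hull T))).
Qed.

(** Half the inradius is a radius that is actually attained. *)
Lemma inscribed_ball T sigma kappa : injective (@vert _ M) -> #|T| = 4 ->
  T \in elts M -> shape_regular M sigma -> quasiuniform M kappa ->
  exists c r, [/\ 0 < r, [set x | enorm (x - c) <= r] `<=` hull T &
    meshsize M <= (1 + 2 * `|sigma * kappa|) * r].
Proof.
move=> vinj T4 TM /(_ _ TM) sreg /(_ _ TM) qunif.
have diam_gt0 : 0 < diam (@hull _ M T).
  have /card_gt1P[i [j [iT jT ij]]] : (1 < #|T|)%N by rewrite T4.
  apply: lt_le_trans (hull_diam (hull_vert iT) (hull_vert jT)).
  rewrite lt_neqAle enorm_ge0 eq_sym enorm_eq0 subr_eq0.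
  by rewrite andbT; apply: contra_neq ij => /vinj.
have inr_neq0 : inradius (@hull _ M T) != 0.
  by apply: contraTneq sreg => ->; rewrite mulr0 -ltNge.
set E := [set r | 0 < r /\ exists c, [set x | enorm (x - c) <= r] `<=` @hull _ M T].
have supE : has_sup E.
  by apply: contrapT => /sup_out E0; move: inr_neq0; rewrite /inradius -/E E0 eqxx.
have inr_gt0 : 0 < inradius (@hull _ M T).
  have [e Ee] := supE.1; have [e0 _] := Ee.
  exact: lt_le_trans e0 (sup_upper_bound supE Ee).
have [r [r0 [c cr]] rsup] := sup_adherent (divr_gt0 inr_gt0 (ltr0Sn R 1)) supE.
exists c, r; split=> //; move: rsup; rewrite -/(inradius _) => rsup.
have {rsup} inr_le : inradius (@hull _ M T) <= 2 * r by lra.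
apply: (@le_trans _ _ (`|sigma * kappa| * (2 * r))); last by lra.
apply: le_trans (ler_wpM2l (normr_ge0 _) inr_le).
apply: le_trans qunif _; apply: (@le_trans _ _ (`|kappa| * diam (@hull _ M T))).
  by rewrite ler_wpM2r ?ler_norm // ltW.
rewrite normrM (mulrC `|sigma|) -mulrA; apply: ler_wpM2l => //.
by apply: le_trans sreg _; rewrite ler_wpM2r ?ler_norm // ltW.
Qed.

Lemma enum_facet F : #|F| = 3 -> exists i0 i1 i2 : ix,
  [/\ F = [set i0; i1; i2]%SET,
      fvert F 0 = vert i0, fvert F 1 = vert i1 & fvert F 2 = vert i2].
Proof.
rewrite /fvert cardE; move: (mem_enum (mem F)).
case: (enum F) => [|i0 [|i1 [|i2 []]]] //= memF _; exists i0, i1, i2; split=> //.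
by apply/setP => i; rewrite -memF !inE -orbA.
Qed.

Lemma exists_orthogonal v : exists2 w, w != 0 & dot w v = 0.
Proof.
have [v1|v1] := eqVneq (v 0 (inord 1)) 0.
  exists (row3 0 1 0); last by rewrite /dot !coordE v1; ring.
  apply: contraTneq (oner_neq0 R) => /rowP/(_ (inord 1)).
  by rewrite row3_1 mxE => ->; rewrite eqxx.
exists (row3 (v 0 (inord 1)) (- v 0 (inord 0)) 0); last by rewrite /dot !coordE; ring.
by apply: contra_neq v1 => /rowP/(_ (inord 0)); rewrite row3_0 mxE.
Qed.

(** The facet [F] leaves out one vertex [d] of [T]. In a direction [w] orthogonal to
    the edge from a vertex [a] of [F] to [d], the simplex extends no further from [a]
    than the edges of [F], while it contains a ball of radius [r]. *)
Lemma facet_edge_energy T F c r : #|T| = 4 -> F \subset T -> #|F| = 3 ->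
  0 < r -> [set x | enorm (x - c) <= r] `<=` hull T ->
  r ^+ 2 <= edge_energy F.
Proof.
move=> T4 FT F3 r0 cr.
have /cards1P[d TFd] : #|T :\: F| == 1%N.
  by rewrite cardsD (finset.setIidPr FT) T4 F3.
have [i0 [i1 [i2 [FE a0 a1 a2]]]] := enum_facet F3.
have [w w0 wd] := exists_orthogonal (vert d - vert i0).
pose m := Num.sqrt (edge_energy F).
have m0 : 0 <= m := sqrtr_ge0 _.
have e1m : enorm (edge1 F) <= m.
  by rewrite ler_wsqrtr // /edge_energy /edge_form -addrA lerDl addr_ge0 ?dot_ge0.
have e2m : enorm (edge2 F) <= m.
  by rewrite ler_wsqrtr // /edge_energy /edge_form addrAC lerDr addr_ge0 ?dot_ge0.
have wm v : dot v (vert d - vert i0) = 0 -> forall i, i \in T ->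
    dot v (vert i - vert i0) <= enorm v * m.
  move=> vd i iT; have [iF|iF] := boolP (i \in F); last first.
    have : i \in T :\: F by rewrite inE iF.
    by rewrite TFd => /set1P ->; rewrite vd mulr_ge0 ?enorm_ge0.
  have le_edge e : enorm e <= m -> dot v e <= enorm v * m.
    by move=> em; rewrite (le_trans (dot_le_enorm _ _)) // ler_wpM2l ?enorm_ge0.
  move: iF; rewrite FE !inE -orbA => /or3P[]/eqP->.
  - by rewrite subrr dot0r mulr_ge0 ?enorm_ge0.
  - by rewrite -a0 -a1; exact: le_edge.
  - by rewrite -a0 -a2; exact: le_edge.
have w_gt0 : 0 < enorm w by rewrite lt_neqAle enorm_ge0 eq_sym enorm_eq0 w0.
have slab v : enorm v = enorm w -> dot v (vert d - vert i0) = 0 ->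
    dot v (c - vert i0) + r * enorm w <= enorm w * m.
  move=> vw vd; rewrite -vw.
  (* The point of the ball that lies farthest in the direction [v]. *)
  have pT : hull T (c + (r / enorm v) *: v).
    apply: cr; rewrite /= addrAC subrr add0r.
    rewrite -(@ler_pXn2r _ 2) ?nnegrE ?enorm_ge0 ?(ltW r0) //.
    by rewrite enorm_sqr dotZl dotZr -enorm_sqr vw mulrA -expr2 -exprMn divfK ?gt_eqF.
  apply: le_trans (hull_dot_le (wm v vd) pT).
  rewrite addrAC [leRHS]dotDr dotZr -enorm_sqr.
  by rewrite (_ : r / _ * _ = r * enorm v) //; field; rewrite vw gt_eqF.
have rm : r <= m.
  have := lerD (slab w erefl wd) (slab (- w) _ _).
  rewrite !dotNl wd oppr0 /(enorm (- w)) dotNl dotNr opprK => /(_ erefl erefl).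
  rewrite addrACA subrr add0r -!mulr2n lerMn2r /= mulrC.
  by rewrite (ler_pM2l w_gt0).
rewrite -[leRHS]sqr_sqrtr ?(ltW (lt_le_trans _ _)) //; last first.
  by rewrite /edge_energy /edge_form !addr_ge0 ?dot_ge0.
by rewrite ler_pXn2r ?nnegrE // ltW.
Qed.

Section InscribedBall.
Variables (T : {set ix}) (c : pt) (r : R).
Hypothesis (r0 : 0 < r) (cr : [set x | enorm (x - c) <= r] `<=` hull T).

Lemma ball_sub_hull : ball c (r / 2) `<=` hull T.
Proof.
move=> x [_ cx]; apply: cr => /=.
rewrite -(@ler_pXn2r _ 2) ?nnegrE ?enorm_ge0 ?(ltW r0) // enorm_sqr /dot sum3.
have sq k : (x - c) 0 k * (x - c) 0 k <= (r / 2) ^+ 2.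
  rewrite -expr2 -real_normK ?num_real // ler_pXn2r ?nnegrE //; last first.
    by rewrite divr_ge0 // ltW.
  by have := cx 0 k; rewrite -ball_normE /= !mxE distrC => /ltW.
apply: le_trans (lerD (lerD (sq _) (sq _)) (sq _)) _.
by rewrite -subr_ge0 (_ : _ - _ = (r / 2) ^+ 2) ?sqr_ge0 //; field.
Qed.

(** The segment from [x] to the centre of the ball enters the interior at once: the
    point at ratio [t] is the centre of a homothetic ball of ratio [t]. *)
Lemma closure_interior_hull x : hull T x -> closure (interior (hull T)) x.
Proof.
move=> xT B /nbhs_ballP[e /= e0 eB].
pose t := Num.min 1 (e / (`|x - c| + 1)).
have n0 : 0 < `|x - c| + 1 by rewrite ltr_wpDl.
have t0 : 0 < t by rewrite lt_min ltr01 divr_gt0.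
have t1 : t <= 1 by rewrite ge_min lexx.
have te : t * `|x - c| < e.
  apply: (@lt_le_trans _ _ (t * (`|x - c| + 1))); first by rewrite ltr_pM2l // ltrDl.
  by rewrite -ler_pdivlMr // ge_min lexx orbT.
pose z := (1 - t) *: x + t *: c; exists z; split; last first.
  apply: eB; rewrite -ball_normE /= /z.
  rewrite (_ : x - _ = t *: (x - c)); last by apply/rowP => i; rewrite !mxE; ring.
  by rewrite normrZ gtr0_norm.
apply/nbhs_ballP; exists (t * (r / 2)) => [|y]; first by rewrite /= mulr_gt0 // divr_gt0.
rewrite -ball_normE /= => zy.
(* Pull [y] back to the ball around [c]. *)
have -> : y = (1 - t) *: x + t *: (c + t^-1 *: (y - z)).
  rewrite scalerDr scalerA mulfV ?gt_eqF // scale1r.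
  by apply/rowP => i; rewrite !mxE; ring.
apply: hull_convex => //; last by rewrite ltW.
apply: ball_sub_hull; rewrite -ball_normE /= opprD addrA subrr add0r.
by rewrite normrN normrZ normfV gtr0_norm // mulrC ltr_pdivrMr // distrC mulrC.
Qed.

(** The ball contains a cube of side [r]. *)
Lemma integral3_interior_ge f k : 0 <= k ->
  (forall x, interior (hull T) x -> f x = k) ->
  ((k * r ^+ 3)%:E <= integral3 (interior (hull T)) f)%E.
Proof.
move=> k0 fk.
pose I i := `](c 0 (inord i) - r / 2), (c 0 (inord i) + r / 2)[%classic : set R.
have mI i : measurable (I i : set (measurableTypeR R)) by exact: measurable_itv.
have muI i : lebesgue_measure (I i) = r%:E :> \bar R.
  rewrite /I; move: (c 0 (inord i) : R) => a.
  rewrite lebesgue_measure_itv /= lte_fin ltrBlDr -addrA ltrDl addr_gt0 ?divr_gt0 //.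
  by congr EFin; rewrite (_ : a + r / 2 - (a - r / 2) = r) //; field.
have cube x : I 0%N (x 0 (inord 0)) -> I 1%N (x 0 (inord 1)) -> I 2%N (x 0 (inord 2)) ->
    interior (hull T) x.
  rewrite /I /= !in_itv /= => x0 x1 x2.
  have sub : ball c (r / 2) `<=` interior (hull T).
    by rewrite -open_subsetE; [exact: ball_sub_hull|exact: ball_open].
  apply: sub; split=> [|i j]; first by rewrite divr_gt0.
  rewrite (ord1 i) -ball_normE /= distrC ltr_distl.
  by rewrite -(inord_val j); case: j => [[|[|[|//]]] ?] /=.
rewrite (_ : (k * r ^+ 3)%:E = k%:E * (@lebesgue_measure R \x @lebesgue_measure R
   \x @lebesgue_measure R)%E ((I 0%N `*` I 1%N) `*` I 2%N))%E; last first.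
  rewrite product_measure1E //; last exact: (measurableX (mI 0%N) (mI 1%N)).
  rewrite (_ : (k * r ^+ 3)%:E = k%:E * (r%:E * r%:E * r%:E))%E; last first.
    by rewrite -!EFinM; congr EFin; ring.
  congr (_ * (_ * _))%E; last by rewrite -(muI 2%N).
  by rewrite -{1}(muI 0%N) -(muI 1%N); apply/esym; exact: product_measure1E.
apply: integral_ge_cst => //.
- exact: (measurableX (measurableX (mI 0%N) (mI 1%N)) (mI 2%N)).
- by move=> [[x0 x1] x2] [[Ix0 Ix1] Ix2]; apply: cube; rewrite coordE.
- by move=> p pT; rewrite lee_fin fk.
- by move=> [[x0 x1] x2] [[Ix0 Ix1] Ix2]; rewrite fk //; apply: cube; rewrite coordE.
Qed.

End InscribedBall.

End Hull.

(** * Piecewise affine fields on a mesh *)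

Section Elements.
Context {R : realType} (M : mesh R).
Notation pt := 'rV[R]_3.
Notation ix := 'I_(nvert M).
Implicit Types (S T F : {set ix}) (E : {set {set ix}}).

Lemma facet_param_in_hull F p : #|F| = 3 -> ref_triangle p -> hull F (facet_param F p).
Proof.
move=> F3 [/= s0 t0 st].
have [i0 [i1 [i2 [FE a0 a1 a2]]]] := enum_facet F3.
have h0 : hull F (vert i0) by apply: hull_vert; rewrite FE !inE eqxx.
have h1 : hull F (vert i1) by apply: hull_vert; rewrite FE !inE eqxx orbT.
have h2 : hull F (vert i2) by apply: hull_vert; rewrite FE !inE eqxx !orbT.
rewrite /facet_param /edge1 /edge2 a0 a1 a2.
have [s1|s1] := eqVneq p.1 1.
  have -> : p.2 = 0 by lra.
  by rewrite s1 scale1r scale0r addr0 addrC subrK.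
have s_lt1 : 0 < 1 - p.1 by rewrite subr_gt0 lt_neqAle s1; lra.
rewrite (_ : _ + _ = (1 - p.1) *: ((1 - p.2 / (1 - p.1)) *: vert i0 +
    (p.2 / (1 - p.1)) *: vert i2) + p.1 *: vert i1).
  apply: hull_convex => //; last by lra.
  apply: hull_convex => //; rewrite divr_ge0 // ?(ltW s_lt1) //= ler_pdivrMr //; lra.
by apply/rowP => i; rewrite !mxE; field; rewrite gt_eqF.
Qed.

(** A tetrahedron has 16 sets of vertices, a crude bound for its number of facets. *)
Lemma sum_facets_elements E (a : {set ix} -> R) : (forall T, 0 <= a T) ->
  (forall T, T \in elts M -> #|T| = 4) ->
  \sum_(F in E) \sum_(T in elts M | F \subset T) a T <= 16 * \sum_(T in elts M) a T.
Proof.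
move=> a0 T4; rewrite (exchange_big_dep (mem (elts M))) /=; last by move=> ? ? _ /andP[].
rewrite mulr_sumr; apply: ler_sum => T TM; rewrite TM /=.
rewrite sumr_const -[leLHS]mulr_natl ler_wpM2r // ler_nat.
rewrite (_ : 16 = #|powerset T|)%N; last by rewrite card_powerset T4.
by apply: subset_leq_card; apply/fintype.subsetP => F; rewrite !inE => /andP[].
Qed.

Section PiecewiseAffine.
Variables (u : pt -> pt) (A : {set ix} -> 'M[R]_3) (b : {set ix} -> pt).
Hypothesis uE : forall T, T \in elts M ->
  forall x, interior (hull T) x -> u x = x *m A T + b T.
Hypothesis ball_in : forall T, T \in elts M ->
  exists c r, 0 < r /\ [set x | enorm (x - c) <= r] `<=` hull T.

Lemma elt_trace_affine T x : T \in elts M -> hull T x ->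
  elt_trace T u x = x *m A T + b T /\ elt_trace T (curl u) x = curl_mx (A T).
Proof.
move=> TM xT; have [c [r [r0 cr]]] := ball_in TM.
have clx := closure_interior_hull r0 cr xT.
split; first exact: (lim_within_affine clx (uE TM)).
rewrite -[RHS]add0r -(mulmx0 _ x); apply: lim_within_affine clx _ => y Ty.
by rewrite mulmx0 add0r (curl_affine (@open_interior _ _) Ty (uE TM)).
Qed.

Lemma jump_affine F : F \in facets M -> exists D v,
  [/\ forall x, hull F x -> jump u F x = x *m D + v,
      forall x, hull F x -> jump (curl u) F x = curl_mx D &
      frob2 (sym_mx D) <=
        2 * \sum_(T in elts M | F \subset T) frob2 (sym_mx (A T))].
Proof.
rewrite inE => /andP[_ /existsP[T0 T0F]].
rewrite /jump; set s := enum _.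
have sM T : T \in s -> T \in elts M /\ hull F `<=` hull T.
  by rewrite mem_enum inE => /andP[TM FT]; split=> //; exact: hullS.
have -> : \sum_(T in elts M | F \subset T) frob2 (sym_mx (A T)) =
    \sum_(T <- s) frob2 (sym_mx (A T)).
  by rewrite big_enum; apply: eq_bigl => T; rewrite inE.
have : T0 \in s by rewrite mem_enum inE.
have sum0 s' : 0 <= \sum_(T <- s') frob2 (sym_mx (A T)).
  by apply: sumr_ge0 => T _; exact: frob2_ge0.
case: s sM => [//|T [|T' s']] sM _.
- have [TM FT] := sM T (mem_head _ _).
  exists (A T), (b T); split=> [x /FT xT|x /FT xT|].
  + by have [] := elt_trace_affine TM xT.
  + by have [] := elt_trace_affine TM xT.
  + by rewrite big_seq1 mulr_natl mulr2n lerDl frob2_ge0.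
- have [TM FT] := sM T (mem_head _ _).
  have [TM' FT'] : T' \in elts M /\ hull F `<=` hull T'.
    by apply: sM; rewrite !inE eqxx orbT.
  exists (A T - A T'), (b T - b T'); split=> [x xF|x xF|].
  + have [-> _] := elt_trace_affine TM (FT x xF).
    have [-> _] := elt_trace_affine TM' (FT' x xF).
    by rewrite /= mulmxBr opprD addrACA.
  + have [_ ->] := elt_trace_affine TM (FT x xF).
    have [_ ->] := elt_trace_affine TM' (FT' x xF).
    by rewrite /= curl_mxB.
  + apply: le_trans (frob2_symB _ _) _; rewrite ler_wpM2l //.
    by rewrite !big_cons addrA lerDl sum0.
Qed.

End PiecewiseAffine.

End Elements.

(** * The equivalence on a facet, and summation *)

(** The scaling argument: [N] is twice the area of a facet, [S] its edge energy, [s]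
    the sum of the squared strains and [d] the squared jump of the strain. The
    conclusions follow from [k^2 <= c^2 / 2 + 2 d] and [c^2 <= 8 k^2 + 8 d]. *)
Lemma facet_estimates (R : realType) (h N S rho s k c d : R) :
  0 < h -> 0 <= N -> N <= h ^+ 2 -> h ^+ 2 <= rho ^+ 2 * S -> S <= 3 * h ^+ 2 ->
  `|k - c / 2| <= Num.sqrt d -> 0 <= d -> d <= 2 * s ->
  h^-1 * (N * S / 72 * k ^+ 2) <= h * (N / 2 * c ^+ 2) + h ^+ 3 * s /\
  h * (N / 2 * c ^+ 2) <=
    288 * rho ^+ 2 * (h^-1 * (N * S / 72 * k ^+ 2)) + 8 * (h ^+ 3 * s).
Proof.
move=> h0 N0 Nh hS Sh kc d0 ds.
have kcd : (k - c / 2) ^+ 2 <= d.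
  by rewrite -real_normK ?num_real // -[leRHS]sqr_sqrtr // ler_pXn2r ?nnegrE ?sqrtr_ge0.
have k_le : k ^+ 2 <= c ^+ 2 / 2 + 4 * s.
  have : 0 <= (k - c) ^+ 2 := sqr_ge0 _.
  nra.
have c_le : c ^+ 2 <= 8 * k ^+ 2 + 16 * s.
  have : 0 <= (c - 4 * k) ^+ 2 := sqr_ge0 _.
  nra.
have s0 : 0 <= s by lra.
have hNs : h * N * s <= h ^+ 3 * s.
  by rewrite ler_wpM2r // exprS ler_wpM2l // (ltW h0).
have hN0 : 0 <= h * N by rewrite mulr_ge0 // (ltW h0).
have hinv : h^-1 * h ^+ 2 = h by rewrite expr2 mulKf // gt_eqF.
have W0 : 0 <= h^-1 * N * k ^+ 2.
  by rewrite mulr_ge0 ?sqr_ge0 // mulr_ge0 // invr_ge0 ltW.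
split.
- apply: (@le_trans _ _ (h * N * k ^+ 2 / 24)).
    have := ler_wpM2l W0 Sh.
    rewrite (_ : h^-1 * N * k ^+ 2 * (3 * h ^+ 2) =
      3 * (h^-1 * h ^+ 2) * N * k ^+ 2); last by ring.
    rewrite hinv; lra.
  have := ler_wpM2l hN0 k_le.
  have : 0 <= h * N * c ^+ 2 by rewrite mulr_ge0 ?sqr_ge0.
  have : 0 <= h * N * s by rewrite mulr_ge0.
  lra.
- have := ler_wpM2l hN0 c_le.
  have := ler_wpM2l W0 hS.
  rewrite (_ : h^-1 * N * k ^+ 2 * (h ^+ 2) =
    (h^-1 * h ^+ 2) * N * k ^+ 2); last by ring.
  rewrite hinv; lra.
Qed.

Section Facets.
Context {R : realType} (M : mesh R).
Notation pt := 'rV[R]_3.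
Notation ix := 'I_(nvert M).
Variables (u : pt -> pt) (A : {set ix} -> 'M[R]_3) (b : {set ix} -> pt) (rho : R).
Hypothesis uE : forall T, T \in elts M ->
  forall x, interior (hull T) x -> u x = x *m A T + b T.
Hypothesis T4 : forall T, T \in elts M -> #|T| = 4.
Hypothesis shape : forall T, T \in elts M -> exists c r,
  [/\ 0 < r, [set x | enorm (x - c) <= r] `<=` hull T & meshsize M <= rho * r].
Hypothesis rho1 : 1 <= rho.
Notation h := (meshsize M).

(** The scaling argument needs a unit normal, hence a nonzero area vector; if the area
    vector vanishes, so do all integrals over the facet. *)
Lemma facet_equivalence F : F \in facets M -> exists p q k : R,
  [/\ 0 <= p, 0 <= q & 0 <= k] /\
  [/\ integral_facet F (fun x =>
        enorm (PiR F (tangential_part F (jump u F)) x) ^+ 2) = p%:E,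
      integral_facet F (fun x =>
        enorm (Pi0 F (tangential_part F (jump u F)) x) ^+ 2) = q%:E &
      integral_facet F (fun x => normal_part F (jump (curl u) F) x ^+ 2) = k%:E] /\
  let s := h ^+ 3 * \sum_(T in elts M | F \subset T) frob2 (sym_mx (A T)) in
  h^-1 * p <= h^-1 * q + h * k + s /\
  h^-1 * q + h * k <= 288 * rho ^+ 2 * (h^-1 * p) + 8 * s.
Proof.
move=> FM.
have F3 : #|F| = 3 by move: FM; rewrite inE => /andP[/eqP].
have [T TM FT] : exists2 T, T \in elts M & F \subset T.
  by move: FM; rewrite inE => /andP[_ /existsP[T /andP[TM FT]]]; exists T.
have [c [r [r0 cr hr]]] := shape TM.
set s0 := \sum_(T in elts M | F \subset T) _.
have s0_ge0 : 0 <= s0 by apply: sumr_ge0 => ? _; exact: frob2_ge0.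
have [i0 [i1 [i2 [FE a0 a1 a2]]]] := enum_facet F3.
have edge_le i j : i \in F -> j \in F -> enorm (@vert _ M i - vert j) <= h.
  move=> iF jF; apply: le_trans (diam_le_meshsize TM).
  by apply: hull_diam; apply: hull_vert; exact: (fintype.subsetP FT).
have [i0F i1F i2F] : [/\ i0 \in F, i1 \in F & i2 \in F].
  by rewrite FE !inE !eqxx !orbT.
have e1h : enorm (edge1 F) <= h by rewrite /edge1 a0 a1 edge_le.
have e2h : enorm (edge2 F) <= h by rewrite /edge2 a0 a2 edge_le.
have e12h : enorm (edge1 F - edge2 F) <= h.
  by rewrite /edge1 /edge2 a0 a1 a2 opprB addrA subrK edge_le.
have h_ge0 : 0 <= h := le_trans (enorm_ge0 _) e1h.
have [N0|N0] := eqVneq (area_vector F) 0.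
  exists 0, 0, 0; split=> //; split; first by split; exact: integral_facet_degenerate.
  rewrite /= !mulr0 !add0r; have s_ge0 : 0 <= h ^+ 3 * s0 by rewrite mulr_ge0 ?exprn_ge0.
  by rewrite s_ge0 mulr_ge0.
have balls S : S \in elts M ->
    exists c r, 0 < r /\ [set x | enorm (x - c) <= r] `<=` @hull _ M S.
  by move=> SM; have [d [t [t0 dt _]]] := shape SM; exists d, t.
have [D [v [jE cE symD]]] := jump_affine uE balls FM.
have [q [k [d [q0 kd PiRE Pi0E curlE]]]] := facet_integrals N0
  (fun p pF => jE _ (facet_param_in_hull F3 pF))
  (fun p pF => cE _ (facet_param_in_hull F3 pF)).
set N := enorm (area_vector F) in PiRE curlE.
set S := edge_energy F in PiRE.
have rS : r ^+ 2 <= S := facet_edge_energy (T4 TM) FT F3 r0 cr.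
have Sh : S <= 3 * h ^+ 2.
  have sq (e : pt) : enorm e <= h -> dot e e <= h ^+ 2.
    by move=> eh; rewrite -enorm_sqr ler_pXn2r ?nnegrE ?enorm_ge0.
  have := lerD (lerD (sq _ e1h) (sq _ e2h)) (sq _ e12h).
  rewrite /S /edge_energy /edge_form; lra.
have h_gt0 : 0 < h.
  rewrite lt_neqAle h_ge0 andbT eq_sym; apply/eqP => h0.
  by have := lt_le_trans (exprn_gt0 2 r0) (le_trans rS Sh); rewrite h0; lra.
have hS : h ^+ 2 <= rho ^+ 2 * S.
  apply: (@le_trans _ _ ((rho * r) ^+ 2)).
    by rewrite ler_pXn2r ?nnegrE // (le_trans h_ge0).
  by rewrite exprMn ler_wpM2l ?sqr_ge0.
have N_ge0 : 0 <= N := enorm_ge0 _.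
have [est1 est2] := facet_estimates h_gt0 N_ge0 (cross_bound h_ge0 e1h e2h)
  hS Sh kd (frob2_ge0 _) symD.
have S0 : 0 <= S by apply: le_trans rS; rewrite sqr_ge0.
rewrite -/s0 in est1 est2; clearbody N S s0.
exists (q + N * S / 72 * k ^+ 2), q, (N / 2 * d ^+ 2); split; [|split=> //].
  by split=> //; rewrite ?addr_ge0 // mulr_ge0 ?sqr_ge0 // divr_ge0 // mulr_ge0.
have q'0 : 0 <= h^-1 * q by rewrite mulr_ge0 // invr_ge0.
rewrite /= !mulrDr; split; first by rewrite -addrA lerD2l.
have rho2 : 1 <= rho ^+ 2 by rewrite expr_ge1 // (le_trans ler01).
rewrite -addrA; apply: lerD => //; rewrite ler_peMl //.
by apply: (le_trans rho2); rewrite ler_peMl ?ler1n // (le_trans ler01).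
Qed.

End Facets.

Unset Implicit Arguments.
Set Strict Implicit.

Theorem lemma3p1 (R : realType) (Om GD GN : set 'rV[R]_3)
    (hOm : lipschitz_domain Om) (hsplit : boundary_split Om GD GN)
    (hrigid : no_rigid_displacement Om GD) (sigma kappa : R) :
  exists c C : R, 0 < c /\ 0 < C /\
  forall (M : mesh R), triangulation M Om GD GN ->
    shape_regular M sigma -> quasiuniform M kappa ->
  forall u : 'rV[R]_3 -> 'rV[R]_3, Vh M Om GD u ->
  let h := meshsize M in
  let E := facets0D M GD GN in
  let jump_t F := tangential_part F (jump u F) in
  let lhs := (sqnorm_eps M u +
    h^-1%:E * sqnorm_facets E (fun F x => enorm (PiR F (jump_t F) x)))%E in
  let rhs := (sqnorm_eps M u +
    h^-1%:E * sqnorm_facets E (fun F x => enorm (Pi0 F (jump_t F) x)) +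
    h%:E * sqnorm_facets E (fun F x => normal_part F (jump (curl u) F) x))%E in
  (c%:E * lhs <= rhs)%E /\ (rhs <= C%:E * lhs)%E.
Proof.
(* The constant of [inscribed_ball]: [h <= rho * r]. *)
pose rho := 1 + 2 * `|sigma * kappa|.
have rho1 : 1 <= rho by rewrite lerDl mulr_ge0.
have rho0 : 0 < rho := lt_le_trans ltr01 rho1.
have rho3 : 0 < rho ^+ 3 by rewrite exprn_gt0.
have rho2 : 0 < rho ^+ 2 by rewrite exprn_gt0.
exists (1 + 16 * rho ^+ 3)^-1, (1 + 288 * rho ^+ 2 + 128 * rho ^+ 3).
split; first by rewrite invr_gt0; lra.
split; first by lra.
move=> M [vinj T4' _ _ _] sreg qunif u [_ uP1] h E jump_t lhs rhs.
have T4 T : T \in elts M -> #|T| = 4 by move=> /T4'[].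
have shape T : T \in elts M -> exists c r,
    [/\ 0 < r, [set x | enorm (x - c) <= r] `<=` hull T & h <= rho * r].
  by move=> TM; exact: (inscribed_ball vinj (T4 _ TM) TM sreg qunif).
have /choice[Ab uE] : forall T, exists Ab : 'M[R]_3 * 'rV[R]_3, T \in elts M ->
    forall x, interior (hull T) x -> u x = x *m Ab.1 + Ab.2.
  move=> T.
  have [TM|TM] := boolP (T \in elts M); last by exists (0, 0).
  by have [A [b Ab]] := uP1 T TM; exists (A, b).
have FE F : F \in E -> F \in facets M.
  by rewrite !inE => /orP[/andP[_]|/andP[]].
pose eps2 T := frob2 (sym_mx (Ab T).1).
(* A lower bound for the strain energy of [T], by [h / rho <= r]. *)
pose a T := (h / rho) ^+ 3 * eps2 T.
have h_ge0 : 0 <= h.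
  by rewrite /h /meshsize; exact: Order.TotalTheory.bigmax_ge_id.
have eps2_ge0 T : 0 <= eps2 T by exact: frob2_ge0.
have a0 T : 0 <= a T by rewrite mulr_ge0 // exprn_ge0 // divr_ge0 // ltW.
pose a_ := \sum_(T in elts M) a T.
have a_ge0 : 0 <= a_ by apply: sumr_ge0.
have eps_ge : (a_%:E <= sqnorm_eps M u)%E.
  rewrite -sumEFin; apply: lee_sum => T TM.
  have [c [r [r0 cr hr]]] := shape T TM.
  apply: (@le_trans _ _ (eps2 T * r ^+ 3)%:E).
    rewrite lee_fin /a mulrC ler_wpM2l // ler_pXn2r ?nnegrE ?(ltW r0) //.
      by rewrite ler_pdivrMr // mulrC.
    by rewrite divr_ge0 // ltW.
  apply: (integral3_interior_ge r0 cr) => // x xT.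
  by rewrite (eps_affine (@open_interior _ _) xT (uE T TM)).
have /choice[pqk pqkE] : forall F, exists pqk : R * R * R, F \in E ->
    [/\ 0 <= pqk.1.1, 0 <= pqk.1.2 & 0 <= pqk.2] /\
    [/\ integral_facet F (fun x => enorm (PiR F (jump_t F) x) ^+ 2) = pqk.1.1%:E,
        integral_facet F (fun x => enorm (Pi0 F (jump_t F) x) ^+ 2) = pqk.1.2%:E &
        integral_facet F (fun x => normal_part F (jump (curl u) F) x ^+ 2) =
          pqk.2%:E] /\
    let s := rho ^+ 3 * \sum_(T in elts M | F \subset T) a T in
    h^-1 * pqk.1.1 <= h^-1 * pqk.1.2 + h * pqk.2 + s /\
    h^-1 * pqk.1.2 + h * pqk.2 <= 288 * rho ^+ 2 * (h^-1 * pqk.1.1) + 8 * s.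
  move=> F; have [/FE FM|FnE] := boolP (F \in E); last by exists (0, 0, 0).
  have [p [q [k [pqk0 [ints ests]]]]] := facet_equivalence uE T4 shape rho1 FM.
  exists (p, q, k) => _; split=> //; split=> //=.
  rewrite (_ : rho ^+ 3 * _ = h ^+ 3 * \sum_(T in elts M | F \subset T) eps2 T) //.
  rewrite /a -mulr_sumr mulrA -exprMn (mulrC rho) divfK //; last by rewrite gt_eqF.
pose s (F : {set 'I_(nvert M)}) := rho ^+ 3 * \sum_(T in elts M | F \subset T) a T.
have sum_s : \sum_(F in E) s F <= 16 * rho ^+ 3 * a_.
  rewrite -mulr_sumr -mulrA mulrCA ler_wpM2l ?(ltW rho3) //.
  exact: sum_facets_elements.
pose p_ := \sum_(F in E) h^-1 * (pqk F).1.1.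
pose q_ := \sum_(F in E) h^-1 * (pqk F).1.2.
pose k_ := \sum_(F in E) h * (pqk F).2.
have p_ge0 : 0 <= p_.
  by apply: sumr_ge0 => F /pqkE[[? _ _] _]; rewrite mulr_ge0 ?invr_ge0.
have q_ge0 : 0 <= q_.
  by apply: sumr_ge0 => F /pqkE[[_ ? _] _]; rewrite mulr_ge0 ?invr_ge0.
have k_ge0 : 0 <= k_ by apply: sumr_ge0 => F /pqkE[[_ _ ?] _]; rewrite mulr_ge0.
have le1 : p_ <= q_ + k_ + 16 * rho ^+ 3 * a_.
  apply: le_trans (lerD (lexx _) sum_s); rewrite -!big_split; apply: ler_sum => F FE'.
  by have [_ [_ []]] := pqkE F FE'.
have le2 : q_ + k_ <= 288 * rho ^+ 2 * p_ + 128 * rho ^+ 3 * a_.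
  apply: (@le_trans _ _ (288 * rho ^+ 2 * p_ + 8 * \sum_(F in E) s F)); last by lra.
  rewrite !mulr_sumr -!big_split; apply: ler_sum => F FE'.
  by have [_ [_ []]] := pqkE F FE'.
have lhsE : lhs = (sqnorm_eps M u + p_%:E)%E.
  congr (_ + _)%E; rewrite /p_ -mulr_sumr EFinM -sumEFin; congr (_ * _)%E.
  by apply: eq_bigr => F /pqkE[_ [[]]].
have rhsE : rhs = (sqnorm_eps M u + (q_ + k_)%:E)%E.
  rewrite EFinD addeA; congr (_ + _ + _)%E;
    rewrite /q_ /k_ -mulr_sumr EFinM -sumEFin; congr (_ * _)%E;
    by apply: eq_bigr => F /pqkE[_ [[]]].
(* If the strain energy is infinite, so are both sides. *)
rewrite {}lhsE {}rhsE; case: (sqnorm_eps M u) eps_ge => [e|_|//].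
  rewrite lee_fin => ae.
  rewrite -!EFinD -!EFinM !lee_fin mulrC ler_pdivrMr; last by lra.
  have ? := ler_wpM2l (ltW rho3) ae; have ? := ler_wpM2l (ltW rho2) (le_trans a_ge0 ae).
  have ? := mulr_ge0 (ltW rho3) q_ge0; have ? := mulr_ge0 (ltW rho3) k_ge0.
  have ? := mulr_ge0 (ltW rho3) p_ge0.
  by split; nra.
by rewrite !addye // !gt0_muley ?lte_fin ?invr_gt0 //; lra.
Qed.
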